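(* There exists a constant $C>0$ such that for every function $f:\Omega\to\mathbb{R}$, if $\mathcal{N}(f)$ is finite, then for every $t>0$, $$\mathbb{E}[(f^\circ_t)^2]\le C\,\frac{\mathcal{N}(f)}{t^{d/2}}.$$
   Context: Let $d\ge 1$. Two points $x,y\in\mathbb{Z}^d$ are neighbours ($x\sim y$) iff $\|x-y\|_2=1$; $\mathbb{B}^d$ is the set of unoriented edges between neighbours. $\Omega=(0,+\infty)^{\mathbb{B}^d}$; an element $\omega=(\omega_e)_{e\in\mathbb{B}^d}\in\Omega$ is called an environment, and $\omega_{x,y}=\omega_{y,x}=\omega_e$ for $e=(x,y)$. Translations act by $(\theta_x\,\omega)_{y,z}=\omega_{x+y,x+z}$. $\mathbb{P}$ is a probability law on $\Omega$ (expectation $\mathbb{E}$), invariant under all $\theta_x$, $x\in\mathbb{Z}^d$, and such that $\omega_e\ge 1$ almost surely for every edge $e$. (As a standing assumption, the random walk with jump rates $\omega_{x,y}$ between neighbours $x,y$ does not explode, almost surely in $\omega$.) Let $(X^\circ_t)_{t\ge0}$ be the continuous-time simple random walk on $\mathbb{Z}^d$ started at $0$, with jump rate $1$ between any two neighbours (independent of the environment), and $\omega^\circ(t)=\theta_{X^\circ_t}\,\omega$. Then $f^\circ_t(\omega)$ is the expectation of $f(\omega^\circ(t))$ over the walk, for fixed $\omega$. Let $B_n=\{-n,\ldots,n\}^d$, $S_n(f)=\sum_{x\in B_n}f(\theta_x\,\omega)$, and $$\mathcal{N}(f)=\sup_{n\in\mathbb{N}}\frac{1}{|B_n|}\mathbb{E}\left[(S_n(f))^2\right],$$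 where $\mathbb{N}$ includes $0$. Functions on $\Omega$ are measurable. *)

(* Defs.v *)
From HB Require Import structures.
From mathcomp Require Import all_boot all_order all_algebra.
From mathcomp Require Import finmap all_classical all_reals all_analysis.

Set Implicit Arguments.
Unset Strict Implicit.
Unset Printing Implicit Defensive.

Import Order.TTheory GRing.Theory Num.Theory.
Import numFieldNormedType.Exports.

Local Open Scope classical_set_scope.
Local Open Scope ring_scope.

Notation Zd d := 'rV[int]_d.

(* The squared Euclidean distance is an integer, so |x - y|_2 = 1 is written
   without taking the square root. *)
Definition neighbours (d : nat) (x y : Zd d) : Prop :=
  \sum_(i < d) (x 0 i - y 0 i) ^+ 2 = 1.

Lemma neighboursD (d : nat) (x y z : Zd d) :
  neighbours y z -> neighbours (x + y) (x + z).
Proof.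
rewrite /neighbours => <-; apply: eq_bigr => i _; rewrite !mxE.
by rewrite opprD addrACA subrr add0r.
Qed.

(* An unoriented edge is the two-point set of its endpoints. *)
Definition is_edge (d : nat) (e : set (Zd d)) : Prop :=
  exists x y, neighbours x y /\ e = [set x; y].

Definition edge (d : nat) : Type := {e : set (Zd d) | is_edge e}.

Definition mk_edge (d : nat) (x y : Zd d) (xy : neighbours x y) : edge d :=
  exist _ [set x; y] (ex_intro _ x (ex_intro _ y (conj xy erefl))).

Lemma is_edge_shift (d : nat) (x : Zd d) (e : edge d) :
  is_edge [set x + z | z in sval e].
Proof.
case: e => _ /= [y [z [yz ->]]]; exists (x + y), (x + z).
by split; [exact: neighboursD | rewrite image_setU !image_set1].
Qed.

Definition shift_edge (d : nat) (x : Zd d) (e : edge d) : edge d :=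
  exist _ [set x + z | z in sval e] (is_edge_shift x e).

Definition env_fun (R : realType) (d : nat) : Type := edge d -> {posnum R}.

HB.instance Definition _ (R : realType) (d : nat) := gen_eqMixin (env_fun R d).
HB.instance Definition _ (R : realType) (d : nat) :=
  gen_choiceMixin (env_fun R d).
HB.instance Definition _ (R : realType) (d : nat) :=
  isPointed.Build (env_fun R d) (fun=> 1%:pos).

Definition cylinders (R : realType) (d : nat) : set (set (env_fun R d)) :=
  [set A : set (env_fun R d) | exists (e : edge d) (B : set R),
    measurable B /\ A = [set w : env_fun R d | B (w e)%:num]].
Arguments cylinders : clear implicits.

(* The space of environments, with its product sigma-algebra. *)
Notation env R d := (g_sigma_algebraType (cylinders R d)).

Definition env_shift (R : realType) (d : nat) (x : Zd d) (w : env R d) :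
  env R d :=
  fun e => w (shift_edge x e).

(* omega_{x,y}, extended by 0 to pairs that are not neighbours. *)
Definition conductance (R : realType) (d : nat) (w : env R d) (x y : Zd d) :
  R :=
  match pselect (neighbours x y) with
  | left xy => (w (mk_edge xy))%:num
  | right _ => 0
  end.

Lemma conductance_shift (R : realType) (d : nat) (w : env R d) (x y z : Zd d) :
  conductance (env_shift x w) y z = conductance w (x + y) (x + z).
Proof.
rewrite /conductance; case: pselect => [yz|nyz]; case: pselect => [xyz|nxyz] //.
- rewrite /env_shift; congr ((w _)%:num); apply: eq_exist => /=.
  by rewrite image_setU !image_set1.
- by case: nxyz; exact: neighboursD.
- by case: nyz; have := neighboursD (- x) xyz; rewrite !addKr.
Qed.

Definition total_rate (R : realType) (d : nat) (w : env R d) (x : Zd d) : R :=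
  \sum_(y \in [set y | neighbours x y]) conductance w x y.

(* Y and T are the successive positions and the holding times of the random
   walk with jump rates w started at x: Y is a Markov chain with transition
   probabilities omega_{x,y} / omega_x and, given Y, the T i are independent
   exponential variables of parameters omega_{Y i}. *)
Record jump_chain (R : realType) (d : nat) (w : env R d) (x : Zd d)
    (dW : measure_display) (W : measurableType dW) (Q : probability W R)
    (Y : nat -> W -> Zd d) (T : nat -> W -> R) : Prop := JumpChain {
  jump_chain_measurable : forall n y, measurable (Y n @^-1` [set y]);
  holding_time_measurable : forall n, measurable_fun setT (T n);
  holding_time_gt0 : forall n u, 0 < T n u;
  jump_chain_law : forall (n : nat) (y : nat -> Zd d) (t : nat -> R),
    (forall i, 0 <= t i) ->
    Q [set u | forall i, (i <= n)%N -> Y i u = y i /\ t i < T i u] =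
    ((y 0%N == x)%:R *
     \prod_(i < n) (conductance w (y i) (y i.+1) / total_rate w (y i)) *
     \prod_(i < n.+1) expR (- (total_rate w (y i) * t i)))%:E
}.

Definition jump_time (R : realType) (W : Type) (T : nat -> W -> R) (n : nat)
  (u : W) : R := \sum_(i < n) T i u.

Definition non_explosive (R : realType) (d : nat) (w : env R d) : Prop :=
  forall (x : Zd d) (dW : measure_display) (W : measurableType dW)
    (Q : probability W R) (Y : nat -> W -> Zd d) (T : nat -> W -> R),
  jump_chain w x Q Y T ->
  {ae Q, forall u, jump_time T n u @[n --> \oo] --> +oo}.

(* X is the walk up to its explosion time; its values from then on are left
   unspecified. *)
Definition is_walk (R : realType) (d : nat) (w : env R d) (x : Zd d)
    (dW : measure_display) (W : measurableType dW) (Q : probability W R)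
    (X : R -> W -> Zd d) : Prop :=
  (forall t y, measurable (X t @^-1` [set y])) /\
  exists (Y : nat -> W -> Zd d) (T : nat -> W -> R),
    jump_chain w x Q Y T /\
    forall n t u, jump_time T n u <= t < jump_time T n.+1 u -> X t u = Y n u.

Definition simple_walk (R : realType) (d : nat) (dW : measure_display)
    (W : measurableType dW) (Q : probability W R) (X : R -> W -> Zd d) : Prop :=
  is_walk ((fun=> 1%:pos) : env R d) 0 Q X.

Definition walk_average (R : realType) (d : nat) (dW : measure_display)
    (W : measurableType dW) (Q : probability W R) (X : R -> W -> Zd d)
    (f : env R d -> R) (t : R) (w : env R d) : \bar R :=
  (\int[Q]_u (f (env_shift (X t u) w))%:E)%E.

Definition box (d n : nat) : set (Zd d) :=
  [set x : Zd d | forall i, - n%:Z <= x 0 i <= n%:Z].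
Arguments box : clear implicits.

Definition box_sum (R : realType) (d : nat) (f : env R d -> R) (n : nat)
  (w : env R d) : R := \sum_(x \in box d n) f (env_shift x w).

Definition calN (R : realType) (d : nat) (P : probability (env R d) R)
    (f : env R d -> R) : \bar R :=
  ereal_sup (range (fun n : nat =>
    ((#|` fset_set (box d n)|%fset%:R^-1)%:E *
     \int[P]_w ((box_sum f n w) ^+ 2)%:E)%E)).

(* Main.v *)
(* For fixed environment, f_t is an average of f over the translates by the
   simple random walk, whose law at time t is a Poisson mixture of powers of
   the lazy operator L = (1 + K) / 2, where K averages over the 2 d unit
   shifts.  Write |g|^2 for E[g^2].

   Two facts control |L^n f| without any Fourier analysis.
   (1) |(tau_e - 1) L^n g|^2 <= C |g|^2 / n for a unit shift tau_e (test the
   steps of the walk against their score and use Cauchy-Schwarz).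
   (2) The average A_m f over the box B_m satisfies |A_m f|^2 <= N(f) / |B_m|.
   Writing L^(4n) f = A_m L^(4n) f + (1 - A_m) L^(3n) (L^n f) with m a small
   multiple of sqrt n gives
     |L^(4n) f|^2 <= 2 N(f) / |B_m| + 2^(-d-1) |L^n f|^2,
   which iterates to |L^n f|^2 <= C N(f) n^(-d/2).  The Poisson mixture costs
   only a negative moment of the Poisson law.

   The law of the walk follows from the jump chain: along a fixed path the
   holding times are independent exponentials, so the number of jumps before
   time t is Poisson. *)
Require Import Defs.
From HB Require Import structures.
From mathcomp Require Import all_boot all_order all_algebra.
From mathcomp Require Import finmap all_classical all_reals all_analysis.
From mathcomp Require Import measurable_realfun.
From mathcomp Require Import ring lra zify.
Import Order.TTheory GRing.Theory Num.Theory.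
Import numFieldNormedType.Exports.
Local Open Scope classical_set_scope.
Local Open Scope ring_scope.

(** * Iterated averages *)

(** Laziness is what makes fact (1) available: the score argument compares two steps that the walk
    itself can make, and with standing still among them the comparison is [tau_e - 1]. For [K] alone
    two steps always differ by a vector with even coordinate sum, and a field alternating on the two
    sublattices shows that [tau_e - 1] need not decay.

    The iteration closes because time and box scale together: multiplying the time by 4 doubles the
    side of the box, so the box term gains the factor [2^(-d)], and the multiple of [sqrt n] is
    fixed so that the increment term gains as much.

    For odd [d] the rate [n^(-d/2)] is a half-integer power; the decay is therefore stated with a
    free scale [s], which leaves only integer negative moments of the Poisson law to bound.

    Finally [walk_average] is an extended-real integral for each single environment, while [f] is
    controlled only in mean square. It may degenerate to a difference of infinities on a null set,
    hence the separate treatment of positive and negative parts and an almost everywhere Jensen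
    inequality. *)

Definition avg {R : realType} {S : finType} {T : Type} (p : S -> R)
  (step : S -> T -> T) (h : T -> R) (w : T) : R :=
  \sum_s p s * h (step s w).

Section average_operator.
Context {R : realType} {S : finType} {T : Type}.
Variables (p : S -> R) (step : S -> T -> T).
Local Notation M := (avg p step).

Lemma iter_avgB n (g h : T -> R) (w : T) :
  iter n M (fun w => g w - h w) w = iter n M g w - iter n M h w.
Proof.
elim: n w => [//|n IH] w; rewrite !iterS /avg -sumrB.
by apply: eq_bigr => s _; rewrite IH mulrBr.
Qed.

(** Used in two ways: with [phi] one of the commuting maps, it exchanges that map with the
    averaging; with [phi] the orbit map sending [x] to [env_shift x w], it carries averages on the
    lattice over to environments. *)
Lemma iter_avg_fcomp (U : Type) (stepU : S -> U -> U) (phi : U -> T)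
    (h : T -> R) n (u : U) :
  (forall s u, phi (stepU s u) = step s (phi u)) ->
  iter n (avg p stepU) (h \o phi) u = iter n M h (phi u).
Proof.
move=> phiE; elim: n u => [//|n IH] u; rewrite !iterS /avg.
by apply: eq_bigr => s _; rewrite IH phiE.
Qed.

Hypotheses (p_ge0 : forall s, 0 <= p s) (p_sum1 : \sum_s p s = 1).

Lemma iter_avg_ge0 n (h : T -> R) w :
  (forall w, 0 <= h w) -> 0 <= iter n M h w.
Proof.
move=> h0; elim: n w => [|n IH] w; first exact: h0.
by rewrite iterS /avg sumr_ge0// => s _; rewrite mulr_ge0.
Qed.

Lemma avg_sqr_le (h : T -> R) w : M h w ^+ 2 <= M (fun w => h w ^+ 2) w.
Proof.
rewrite -subr_ge0.
(* the difference is the variance of [h] under the weights [p] *)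
rewrite [leRHS](_ : _ = \sum_s p s * (h (step s w) - M h w) ^+ 2).
  by rewrite sumr_ge0// => s _; rewrite mulr_ge0// sqr_ge0.
transitivity (M (fun w => h w ^+ 2) w - 2 * M h w * M h w
    + (\sum_s p s) * M h w ^+ 2); first by rewrite p_sum1; ring.
rewrite mulr_suml {1}/avg {2}/avg mulr_sumr -sumrB -big_split/=.
by apply: eq_bigr => s _; ring.
Qed.

Lemma iter_avg_sqr_le n (h : T -> R) w :
  iter n M h w ^+ 2 <= iter n M (fun w => h w ^+ 2) w.
Proof.
elim: n w => [//|n IH] w; rewrite !iterS; apply: le_trans (avg_sqr_le _ _) _.
by rewrite /avg ler_sum// => s _; rewrite ler_wpM2l.
Qed.

Variables (a b : S).
Hypotheses (ab : a != b) (pa : 0 < p a) (pb : 0 < p b).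
Hypothesis step_comm : forall s s' w, step s (step s' w) = step s' (step s w).

(** The score of moving mass from [b] to [a]: the logarithmic derivative of the weights
    [p + eps * (1_a - 1_b)] at [eps = 0]. Weighting by it turns an average into a difference. *)
Let zeta s : R := (s == a)%:R / p a - (s == b)%:R / p b.

Let ba : (b == a) = false. Proof. by rewrite eq_sym (negPf ab). Qed.

Let sum_zeta (g : S -> R) : \sum_s p s * zeta s * g s = g a - g b.
Proof.
rewrite (bigD1 a)//= (bigD1 b) 1?eq_sym//= big1 => [|s /andP[/negPf sa /negPf sb]].
  rewrite /zeta !eqxx ba (negPf ab) /= mulr1n mulr0n addr0; field.
  by rewrite !gt_eqF.
by rewrite /zeta sa sb /= mulr0n; ring.
Qed.

Let stepz s (x : R * T) : R * T := (x.1 + zeta s, step s x.2).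

(** The first coordinate of [stepz] accumulates the score along the path; [z] is arbitrary because
    the induction restarts after one step. In the cross term each of the [n] steps contributes the
    same difference averaged over the other [n.-1], since the steps commute. *)
Let iter_avg_score (mu : R) (h : T -> R) n z w :
  iter n (avg p stepz) (fun x => (h x.2 - mu * x.1) ^+ 2) (z, w) =
  iter n M (fun w => h w ^+ 2) w
  - 2 * mu * (z * iter n M h w
              + n%:R * iter n.-1 M (fun w => h (step a w) - h (step b w)) w)
  + mu ^+ 2 * (z ^+ 2 + n%:R * ((p a)^-1 + (p b)^-1)).
Proof.
elim: n z w => [|n IH] z w; first by rewrite /=; ring.
rewrite iterS {1}/avg; under eq_bigr do rewrite IH.
rewrite [in RHS]iterS [avg p step (iter _ _ (fun w => h w ^+ 2)) w]/avg.
rewrite [iter n.+1 _ h]iterS [avg _ _ (iter n _ h) w]/avg.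
set d := fun w => _ - _.
(* At [n = 0] the truncated predecessor is meaningless, but the factor [n%:R] vanishes. *)
have hd : n%:R * (M (iter n.-1 M d) w) = n%:R * iter n M d w.
  by case: n {IH} => [|n]; rewrite ?mul0r.
have hz : \sum_s p s * zeta s * iter n M h (step s w) = iter n M d w.
  rewrite sum_zeta /d iter_avgB; congr (_ - _).
  - by rewrite (iter_avg_fcomp _ step (step a)).
  - by rewrite (iter_avg_fcomp _ step (step b)).
have hz1 : \sum_s p s * zeta s = 0.
  by under eq_bigr do rewrite -[_ * _]mulr1; rewrite (sum_zeta (fun=> 1)) subrr.
have hz2 : \sum_s p s * zeta s ^+ 2 = (p a)^-1 + (p b)^-1.
  under eq_bigr do rewrite expr2 mulrA; rewrite sum_zeta /zeta !eqxx.
  by rewrite ba (negPf ab) /= mulr1n mulr0n; ring.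
rewrite -[n.+1.-1]/n -natr1.
transitivity (\sum_s p s * iter n M (fun w => h w ^+ 2) (step s w)
  - 2 * mu * (z * \sum_s p s * iter n M h (step s w)
     + \sum_s p s * zeta s * iter n M h (step s w)
     + n%:R * \sum_s p s * iter n.-1 M d (step s w))
  + mu ^+ 2 * (z ^+ 2 * \sum_s p s + 2 * z * \sum_s p s * zeta s
      + \sum_s p s * zeta s ^+ 2
      + n%:R * ((p a)^-1 + (p b)^-1) * \sum_s p s)).
  rewrite !mulr_sumr -!big_split/= mulr_sumr -sumrB mulr_sumr -big_split/=.
  by apply: eq_bigr => s _; ring.
by rewrite hz hz1 hz2 p_sum1 -[\sum_s _ * iter n.-1 M d _]/(M (iter n.-1 M d) w) hd; ring.
Qed.

(* Along the random path [s_1, ..., s_{n+1}] the score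
   [sum_i (1{s_i = a} / p a - 1{s_i = b} / p b)] is centered, with second
   moment [n+1] times [1 / p a + 1 / p b]; testing it against [h] and
   exchanging the steps produces the difference below. *)
Lemma iter_avg_diff_sqr n (h : T -> R) w :
  n.+1%:R * iter n M (fun w => h (step a w) - h (step b w)) w ^+ 2 <=
  ((p a)^-1 + (p b)^-1) * iter n.+1 M (fun w => h w ^+ 2) w.
Proof.
set v := _ + _; set d := fun w => _ - _.
have v0 : 0 < v by rewrite addr_gt0// invr_gt0.
set D := iter n M d w.
suff : 0 <= iter n.+1 M (fun w => h w ^+ 2) w - n.+1%:R * D ^+ 2 / v.
  by rewrite subr_ge0 ler_pdivrMr// mulrC [leRHS]mulrC [X in X <= _]mulrC.
(* The multiplier [D / v] minimises the quadratic in [mu] computed by [iter_avg_score]. *)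
have : 0 <= iter n.+1 (avg p stepz)
    (fun x => (h x.2 - (D / v) * x.1) ^+ 2) (0, w).
  elim: n.+1 (0, w) => [|m IH] x; first exact: sqr_ge0.
  by rewrite iterS /avg sumr_ge0// => s _; rewrite mulr_ge0.
rewrite iter_avg_score /= -/d -/D -/v; congr (0 <= _).
by rewrite mul0r expr0n/= !add0r; field; rewrite gt_eqF.
Qed.

End average_operator.

(** * Square norms under measure-preserving steps *)

Definition sqnorm {R : realType} {dT : measure_display} {T : measurableType dT}
  (mu : {measure set T -> \bar R}) (h : T -> R) : \bar R :=
  (\int[mu]_w (h w ^+ 2)%:E)%E.

Definition preserves {R : realType} {dT : measure_display}
  {T : measurableType dT} (mu : {measure set T -> \bar R}) (phi : T -> T) :=
  measurable_fun setT phi /\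
  forall A, measurable A -> mu (phi @^-1` A) = mu A.

Section square_norm.
Context {R : realType} {dT : measure_display} {T : measurableType dT}.
Variable mu : {measure set T -> \bar R}.

Lemma sqnorm_ge0 (h : T -> R) : (0 <= sqnorm mu h)%E.
Proof. by apply: integral_ge0 => w _; rewrite lee_fin sqr_ge0. Qed.

Lemma measurable_sqrE (h : T -> R) : measurable_fun setT h ->
  measurable_fun setT (fun w => (h w ^+ 2)%:E).
Proof. by move=> mh; apply/measurable_EFinP/measurable_funX. Qed.

Lemma ge0_integral_preserves (phi : T -> T) (h : T -> \bar R) :
  preserves mu phi -> measurable_fun setT h -> (forall w, 0 <= h w)%E ->
  (\int[mu]_w h (phi w) = \int[mu]_w h w)%E.
Proof.
move=> [mphi phiP] mh h0.
transitivity (\int[pushforward mu phi]_w h w)%E.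
  by rewrite ge0_integral_pushforward.
by apply: eq_measure_integral => A mA _; exact: phiP.
Qed.

Lemma sqnorm_preserves (phi : T -> T) (h : T -> R) :
  preserves mu phi -> measurable_fun setT h ->
  sqnorm mu (h \o phi) = sqnorm mu h.
Proof.
move=> phiP mh; rewrite /sqnorm /=.
rewrite (ge0_integral_preserves phi (fun w => (h w ^+ 2)%:E))//.
- exact: measurable_sqrE.
- by move=> w; rewrite lee_fin sqr_ge0.
Qed.

Lemma sqnormZ (k : R) (h : T -> R) : measurable_fun setT h ->
  sqnorm mu (fun w => k * h w) = ((k ^+ 2)%:E * sqnorm mu h)%E.
Proof.
move=> mh; rewrite /sqnorm -ge0_integralZl_EFin//.
- by apply: eq_integral => w _; rewrite exprMn EFinM.
- by move=> w _; rewrite lee_fin sqr_ge0.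
- exact: measurable_sqrE.
- exact: sqr_ge0.
Qed.

(** Young's inequality, with gap [(c * g - h)^2 / c]. The parameter stays free so that sums can be
    built one term at a time without loss. *)
Lemma sqnormD_le (c : R) (g h : T -> R) (a b : R) : 0 < c ->
  measurable_fun setT g -> measurable_fun setT h ->
  (sqnorm mu g <= a%:E)%E -> (sqnorm mu h <= b%:E)%E ->
  (sqnorm mu (fun w => g w + h w)%R <= ((1 + c) * a + (1 + c^-1) * b)%:E)%E.
Proof.
move=> c0 mg mh ga hb.
have c1 : 0 <= 1 + c by rewrite addr_ge0// ltW.
have c2 : 0 <= 1 + c^-1 by rewrite addr_ge0// invr_ge0 ltW.
apply: (@le_trans _ _ ((1 + c)%:E * sqnorm mu g + (1 + c^-1)%:E * sqnorm mu h)%E);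
  last first.
  by rewrite [leRHS]EFinD !EFinM leeD// lee_wpmul2l// lee_fin.
rewrite /sqnorm -!ge0_integralZl_EFin//; first last.
- exact: measurable_sqrE.
- by move=> w _; rewrite lee_fin sqr_ge0.
- exact: measurable_sqrE.
- by move=> w _; rewrite lee_fin sqr_ge0.
have mZ (k : R) (f : T -> R) : measurable_fun setT f ->
    measurable_fun setT (fun w : T => (k%:E * (f w ^+ 2)%:E)%E).
  move=> mf; apply: measurable_funeM; exact: measurable_sqrE.
rewrite -ge0_integralD//; first last.
- exact: mZ.
- by move=> w _; rewrite -EFinM lee_fin mulr_ge0// sqr_ge0.
- exact: mZ.
- by move=> w _; rewrite -EFinM lee_fin mulr_ge0// sqr_ge0.
apply: ge0_le_integral => //.
- by move=> w _; rewrite lee_fin sqr_ge0.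
- by apply: measurable_sqrE; exact: measurable_funD.
- by apply: emeasurable_funD; exact: mZ.
- move=> w _; rewrite -!EFinM -EFinD lee_fin -subr_ge0.
  rewrite [leRHS](_ : _ = (c * g w - h w) ^+ 2 / c).
    by rewrite mulr_ge0 ?sqr_ge0// invr_ge0 ltW.
  by field; rewrite gt_eqF.
Qed.

Section averages.
Variables (S : finType) (p : S -> R) (step : S -> T -> T).
Hypotheses (p_ge0 : forall s, 0 <= p s) (p_sum1 : \sum_s p s = 1).
Hypothesis stepP : forall s, preserves mu (step s).
Local Notation M := (avg p step).

Lemma measurable_avg (h : T -> R) :
  measurable_fun setT h -> measurable_fun setT (M h).
Proof.
move=> mh; apply: measurable_sum => s; apply: measurable_funM => //.
by apply: measurableT_comp => //; case: (stepP s).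
Qed.

Lemma measurable_iter_avg n (h : T -> R) :
  measurable_fun setT h -> measurable_fun setT (iter n M h).
Proof. by move=> mh; elim: n => [//|n IH]; exact: measurable_avg. Qed.

Lemma ge0_integral_iter_avg n (h : T -> R) :
  measurable_fun setT h -> (forall w, 0 <= h w) ->
  (\int[mu]_w (iter n M h w)%:E = \int[mu]_w (h w)%:E)%E.
Proof.
move=> mh h0; elim: n => [//|n <-].
have g0 : forall w, 0 <= iter n M h w by move=> w; exact: iter_avg_ge0.
have mg : measurable_fun setT (iter n M h) by exact: measurable_iter_avg.
rewrite iterS; set g := iter n M h in g0 mg *.
rewrite /avg; under eq_integral do rewrite -sumEFin.
rewrite ge0_integral_sum//; last 2 first.
- move=> s; apply/measurable_EFinP; apply: measurable_funM => //.
  by apply: measurableT_comp => //; case: (stepP s).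
- by move=> s w _; rewrite lee_fin mulr_ge0.
transitivity (\sum_s (p s)%:E * \int[mu]_w (g w)%:E)%E.
  apply: eq_bigr => s _.
  under eq_integral do rewrite EFinM.
  rewrite ge0_integralZl_EFin//; last 2 first.
  - by move=> w _; rewrite lee_fin.
  - apply/measurable_EFinP.
    by apply: measurableT_comp => //; case: (stepP s).
  congr (_ * _)%E.
  rewrite (ge0_integral_preserves (step s) (fun w => (g w)%:E))//.
  exact/measurable_EFinP.
rewrite -ge0_sume_distrl => [|s _]; last by rewrite lee_fin.
by rewrite sumEFin p_sum1 mul1e.
Qed.

(** Jensen's inequality pointwise, then invariance of [mu] under each step. *)
Lemma sqnorm_iter_avg_le n (h : T -> R) :
  measurable_fun setT h -> (sqnorm mu (iter n M h) <= sqnorm mu h)%E.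
Proof.
move=> mh; rewrite /sqnorm -(ge0_integral_iter_avg n (fun w => h w ^+ 2)).
- apply: ge0_le_integral => //.
  + by move=> w _; rewrite lee_fin sqr_ge0.
  + by apply: measurable_sqrE; exact: measurable_iter_avg.
  + apply/measurable_EFinP; apply: measurable_iter_avg.
    exact: measurable_funX.
  + by move=> w _; rewrite lee_fin iter_avg_sqr_le.
- exact: measurable_funX.
- by move=> w; exact: sqr_ge0.
Qed.

Lemma sqnorm_iter_avg_diff (a b : S) n (h : T -> R) (k : R) :
  a != b -> 0 < p a -> 0 < p b ->
  (forall s s' w, step s (step s' w) = step s' (step s w)) ->
  measurable_fun setT h -> (sqnorm mu h <= k%:E)%E ->
  (sqnorm mu (iter n M (fun w => h (step a w) - h (step b w))%R) <=
    (((p a)^-1 + (p b)^-1) / n.+1%:R * k)%:E)%E.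
Proof.
move=> ab pa pb stepC mh hk.
set v := (p a)^-1 + _; have v0 : 0 <= v by rewrite addr_ge0// invr_ge0.
have vn0 : 0 <= v / n.+1%:R by rewrite divr_ge0.
apply: (@le_trans _ _ ((v / n.+1%:R)%:E * sqnorm mu h)%E); last first.
  by rewrite [leRHS]EFinM lee_wpmul2l// lee_fin.
rewrite [sqnorm mu h]/sqnorm -(ge0_integral_iter_avg n.+1 (fun w => h w ^+ 2));
  last 2 first.
- exact: measurable_funX.
- by move=> w; exact: sqr_ge0.
have mh2 : measurable_fun setT (iter n.+1 M (fun w => h w ^+ 2)).
  by apply: measurable_iter_avg; exact: measurable_funX.
have h20 w : 0 <= iter n.+1 M (fun w => h w ^+ 2) w.
  by apply: iter_avg_ge0 => // x; exact: sqr_ge0.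
rewrite -ge0_integralZl_EFin//; last 2 first.
- by move=> w _; rewrite lee_fin.
- exact/measurable_EFinP.
apply: ge0_le_integral => //.
- by move=> w _; rewrite lee_fin sqr_ge0.
- apply: measurable_sqrE; apply: measurable_iter_avg; apply: measurable_funB.
  + by apply: measurableT_comp => //; case: (stepP a).
  + by apply: measurableT_comp => //; case: (stepP b).
- by apply: measurable_funeM; exact/measurable_EFinP.
- move=> w _; rewrite -EFinM lee_fin mulrAC ler_pdivlMr// mulrC.
  exact: iter_avg_diff_sqr.
Qed.

End averages.
End square_norm.

(** * Translations of the environment *)

Lemma iter_avg_scale_sum {R : realType} {S : finType} {T : Type} (p : S -> R)
    (step : S -> T -> T) (I : Type) (r : seq I) (k : R) (a : I -> T -> R) n w :
  iter n (avg p step) (fun w => k * \sum_(i <- r) a i w) w =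
  k * \sum_(i <- r) iter n (avg p step) (a i) w.
Proof.
elim: n w => [//|n IH] w; rewrite iterS {1}/avg.
under eq_bigr do rewrite IH.
rewrite mulr_sumr; under [in RHS]eq_bigr do rewrite iterS /avg mulr_sumr.
rewrite exchange_big; apply: eq_bigr => s _ /=.
by rewrite mulrCA !mulr_sumr; apply: eq_bigr => i _; ring.
Qed.

(** Stands in for Minkowski's inequality when all terms share one bound, without square roots of
    extended reals. *)
Lemma sqnorm_sum_le {R : realType} {dT : measure_display}
    {T : measurableType dT} (mu : {measure set T -> \bar R}) (I : eqType)
    (r : seq I) (a : I -> T -> R) (b : R) :
  (forall i, measurable_fun setT (a i)) ->
  {in r, forall i, (sqnorm mu (a i) <= b%:E)%E} ->
  (sqnorm mu (fun w => \sum_(i <- r) a i w)%R <= ((size r)%:R ^+ 2 * b)%:E)%E.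
Proof.
move=> ma; elim: r => [_|i r IH ab].
  rewrite expr0n mul0r /sqnorm; under eq_integral do rewrite big_nil expr0n/=.
  by rewrite integral0.
have bi : (sqnorm mu (a i) <= b%:E)%E by apply: ab; rewrite mem_head.
have br : {in r, forall i, (sqnorm mu (a i) <= b%:E)%E}.
  by move=> j jr; apply: ab; rewrite inE jr orbT.
under [X in sqnorm _ X]eq_fun do rewrite big_cons.
case: r IH br {ab} => [_ _|j r IH br].
  by under [X in sqnorm _ X]eq_fun do rewrite big_nil addr0; rewrite expr1n mul1r.
set l := size (j :: r) in IH *.
have l0 : 0 < l%:R :> R by rewrite ltr0n.
(* With [c = l] the bound is exact: [(1 + l) b + (1 + 1/l) l^2 b = (l + 1)^2 b]. A singleton was set
   apart because [c] must be positive. *)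
apply: le_trans (sqnormD_le mu l%:R (a i) _ _ _ l0 (ma i) _ bi (IH br)) _.
  by apply: measurable_sum.
rewrite lee_fin -[size _]/l.+1 -natr1 le_eqVlt; apply/orP; left; apply/eqP.
by field; rewrite gt_eqF.
Qed.

Section lattice.
Context {R : realType} {d : nat}.
Implicit Types (x y : Zd d) (w : env R d).

Lemma env_shiftD x y w : env_shift x (env_shift y w) = env_shift (y + x) w.
Proof.
apply/funext => e; rewrite /env_shift; congr (w _).
apply: eq_exist => /=; rewrite image_comp; apply: eq_imagel => z _ /=.
by rewrite addrA.
Qed.

Lemma env_shiftC x y w :
  env_shift x (env_shift y w) = env_shift y (env_shift x w).
Proof. by rewrite !env_shiftD addrC. Qed.

Lemma env_shift0 w : env_shift 0 w = w.
Proof.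
apply/funext => e; rewrite /env_shift; congr (w _); case: e => e he.
apply: eq_exist => /=; rewrite -[RHS]image_id; apply: eq_imagel => z _.
by rewrite add0r.
Qed.

Lemma measurable_env_shift x : measurable_fun setT (@env_shift R d x).
Proof.
apply: (@measurability _ _ (env R d : measurableType _)
  (env R d : measurableType _) setT _ (cylinders R d) erefl) => // _ [_ [e [B [mB ->]]] <-].
rewrite setTI; apply: sub_sigma_algebra.
by exists (shift_edge x e), B.
Qed.

Definition unit_vec (e : 'I_d * bool) : Zd d :=
  (-1) ^+ e.2 *: delta_mx 0 e.1.

Definition lazy_weight (s : option ('I_d * bool)) : R :=
  if s is Some _ then (4 * d%:R)^-1 else 2^-1.

Definition lazy_step (T : Type) (act : Zd d -> T -> T)
  (s : option ('I_d * bool)) : T -> T :=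
  if s is Some e then act (unit_vec e) else id.

(** The action is a parameter so that the same operator lives on environments, where the decay is
    proved, and on the lattice, where the law of the walk is computed. *)
Definition lazy (T : Type) (act : Zd d -> T -> T) : (T -> R) -> T -> R :=
  avg lazy_weight (lazy_step T act).

Lemma lazy_weight_ge0 s : 0 <= lazy_weight s.
Proof. by case: s => [e|] /=; rewrite invr_ge0// mulr_ge0. Qed.

Lemma big_option (T : finType) (F : option T -> R) :
  \sum_s F s = F None + \sum_x F (Some x).
Proof.
rewrite (bigD1 None)//=; congr (_ + _).
rewrite (reindex_omap Some id)/=; last by case.
by apply: eq_bigl => x; rewrite eqxx.
Qed.

Lemma lazy_weight_sum1 : (0 < d)%N -> \sum_s lazy_weight s = 1.
Proof.
move=> d0; rewrite big_option/= sumr_const card_prod card_ord card_bool.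
have d0' : d%:R != 0 :> R by rewrite pnatr_eq0 -lt0n.
by rewrite -[_ *+ (d * 2)]mulr_natr natrM; field.
Qed.

Definition box_point (n : nat) (g : {ffun 'I_d -> 'I_(2 * n).+1}) : Zd d :=
  \row_i ((g i)%:Z - n%:Z).

Lemma box_fset n :
  box d n = [set` [fset box_point n g | g : {ffun 'I_d -> 'I_(2 * n).+1}]%fset].
Proof.
apply/seteqP; split=> [x xn|x /= /imfsetP[g _ ->] i] /=; last first.
  by rewrite mxE; case: (g i) => k /= kn; lia.
have xi i : (absz (x 0 i + n%:Z)%R < (2 * n).+1)%N.
  by have := xn i; lia.
apply/imfsetP; exists [ffun i => Ordinal (xi i)] => //.
apply/rowP => i; rewrite mxE ffunE /=.
by have := xn i; lia.
Qed.

Lemma finite_box n : finite_set (box d n).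
Proof. by rewrite box_fset; exact: finite_fset. Qed.

Lemma card_box n : #|` fset_set (box d n)|%fset = ((2 * n).+1 ^ d)%N.
Proof.
rewrite box_fset set_fsetK card_imfset/=; last first.
  move=> g h /rowP gh; apply/ffunP => i; apply/val_inj.
  by have := gh i; rewrite !mxE => /addIr[].
by rewrite -[RHS]/(_ ^ d)%N -cardE card_ffun !card_ord.
Qed.

(** Coordinate by coordinate, the path makes [|x 0 i|] steps of the sign of [x 0 i]. Its length is
    the price of comparing [g] with its translate by [x]. *)
Lemma box_path n x : box d n x ->
  exists s, (size s <= d * n)%N /\ x = \sum_(e <- s) unit_vec e.
Proof.
move=> xn.
exists (flatten [seq nseq `|x 0 i| (i, x 0 i < 0) | i <- enum 'I_d]); split.
  rewrite size_flatten /shape -map_comp sumnE big_map big_enum/=.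
  have -> : (d * n = \sum_(i in 'I_d) n)%N by rewrite sum_nat_const card_ord.
  by apply: leq_sum => i _; rewrite size_nseq; have := xn i; lia.
rewrite big_flatten/= big_map big_enum/= [LHS]row_sum_delta.
apply: eq_bigr => i _; rewrite big_nseq iter_addr addr0 /unit_vec/=.
rewrite -scaler_nat scalerA natz; congr (_ *: _).
by case: (ltP (x 0 i) 0) => xi /=; rewrite ?expr0 ?expr1; lia.
Qed.

End lattice.

(** * Decay along the lazy walk *)

Section decay.
Context {R : realType} {d : nat}.
Variable P : probability (env R d) R.
Hypothesis d_gt0 : (0 < d)%N.
Hypothesis P_invariant : forall (x : Zd d) (A : set (env R d)),
  measurable A -> P (env_shift x @^-1` A) = P A.

Local Notation V := (sqnorm P).
Local Notation L := (lazy (env R d) (@env_shift R d)).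

Lemma env_shift_preserves (x : Zd d) : preserves P (@env_shift R d x).
Proof. by split; [exact: measurable_env_shift | exact: P_invariant]. Qed.

Lemma lazy_step_preserves s :
  preserves P (lazy_step (env R d) (@env_shift R d) s).
Proof.
case: s => [e|] /=; first exact: env_shift_preserves.
by split=> //; exact: measurable_id.
Qed.

Lemma measurable_comp_shift (x : Zd d) (g : env R d -> R) :
  measurable_fun setT g -> measurable_fun setT (fun w => g (env_shift x w)).
Proof. by move=> mg; apply: measurableT_comp => //; exact: measurable_env_shift. Qed.

Lemma measurable_iter_lazy n (g : env R d -> R) :
  measurable_fun setT g -> measurable_fun setT (iter n L g).
Proof. exact: (measurable_iter_avg P) lazy_step_preserves n g. Qed.

Lemma sqnorm_iter_lazy_le n (g : env R d -> R) :
  measurable_fun setT g -> (V (iter n L g) <= V g)%E.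
Proof.
exact: (sqnorm_iter_avg_le P _ _ _ lazy_weight_ge0 (lazy_weight_sum1 d_gt0)
  lazy_step_preserves).
Qed.

Lemma iter_lazy_shift n (x : Zd d) (g : env R d -> R) w :
  iter n L (fun w => g (env_shift x w)) w = iter n L g (env_shift x w).
Proof.
apply: (iter_avg_fcomp _ _ _ _ (@env_shift R d x)) => -[e|] u //=.
exact: env_shiftC.
Qed.

Lemma sqnorm_iter_lazy_diff n (e : 'I_d * bool) (h : env R d -> R) (k : R) :
  measurable_fun setT h -> (V h <= k%:E)%E ->
  (V (fun w => iter n L h (env_shift (unit_vec e) w) - iter n L h w)%R <=
    ((4 * d%:R + 2) / n.+1%:R * k)%:E)%E.
Proof.
move=> mh hk.
have d0 : 0 < d%:R :> R by rewrite ltr0n.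
(* The two compared steps are [Some e], of weight [1 / (4 d)], and [None], of weight [1 / 2]: hence
   the constant [4 d + 2]. *)
have := sqnorm_iter_avg_diff P _ (@lazy_weight R d)
  (lazy_step _ (@env_shift R d)) lazy_weight_ge0 (lazy_weight_sum1 d_gt0)
  lazy_step_preserves (Some e) None n h k.
rewrite /= !invrK; set f := iter n _ _ => fk.
rewrite [X in sqnorm P X](_ : _ = f); last first.
  by apply/funext => w; rewrite /f iter_avgB -iter_lazy_shift.
apply: fk => //; first by rewrite invr_gt0 mulr_gt0.
by move=> [e1|] [e2|] w //=; exact: env_shiftC.
Qed.

(** Telescoping along the path: each increment is a unit increment composed with a translation, and
    [P] is translation invariant. *)
Lemma sqnorm_shift_path (g : env R d -> R) (b : R) (s : seq ('I_d * bool)) :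
  measurable_fun setT g ->
  (forall e, (V (fun w => g (env_shift (unit_vec e) w) - g w)%R <= b%:E)%E) ->
  (V (fun w => g (env_shift (\sum_(e <- s) unit_vec e) w) - g w)%R <=
    ((size s)%:R ^+ 2 * b)%:E)%E.
Proof.
move=> mg gb.
pose x j := \sum_(e <- take j s) unit_vec e : Zd d.
pose a j w := g (env_shift (x j.+1) w) - g (env_shift (x j) w).
rewrite [X in sqnorm P X](_ : _ = fun w => \sum_(j <- index_iota 0 (size s)) a j w);
  last first.
  apply/funext => w; rewrite telescope_sumr// /x take_size take0 big_nil.
  by rewrite env_shift0.
have := sqnorm_sum_le P _ (index_iota 0 (size s)) a b.
rewrite size_iota subn0; apply=> [j|j].
  by apply: measurable_funB; exact: measurable_comp_shift.
rewrite mem_index_iota => /= js.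
case: s js @x @a => [//|e0 s] js x a.
pose e := nth e0 (e0 :: s) j.
have xS : x j.+1 = x j + unit_vec e.
  by rewrite /x (take_nth e0)// -cats1 big_cat/= big_seq1.
rewrite [X in sqnorm P X](_ : _ = (fun w => g (env_shift (unit_vec e) w) - g w)
   \o @env_shift R d (x j)); last first.
  by apply/funext => w; rewrite /a /= env_shiftD xS.
rewrite sqnorm_preserves//; first exact: env_shift_preserves.
by apply: measurable_funB => //; exact: measurable_comp_shift.
Qed.

Variables (f : env R d -> R) (r : R).
Hypotheses (mf : measurable_fun setT f) (calN_r : (calN P f <= r%:E)%E).

Let B m := fset_set (box d m).

Let sizeB m : size (B m) = ((2 * m).+1 ^ d)%N.
Proof. exact: card_box. Qed.

Let avgB m (g : env R d -> R) w : R :=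
  ((2 * m).+1 ^ d)%:R^-1 * \sum_(x <- B m) g (env_shift x w).

Let cardB_gt0 m : 0 < ((2 * m).+1 ^ d)%:R :> R.
Proof. by rewrite ltr0n expn_gt0. Qed.

(** One of the two factors [1 / |B_m|] of the squared average is absorbed in [calN]; the other one
    remains. *)
Lemma sqnorm_box_avg m : (V (avgB m f) <= (r / (2 * m).+1%:R ^+ d)%:E)%E.
Proof.
set c := ((2 * m).+1 ^ d)%:R : R.
have msum : measurable_fun setT (fun w => \sum_(x <- B m) f (env_shift x w)).
  by apply: measurable_sum => x; exact: measurable_comp_shift.
rewrite sqnormZ// -/c.
have : ((c^-1)%:E * V (fun w => \sum_(x <- B m) f (env_shift x w))%R <= r%:E)%E.
  apply: le_trans calN_r; apply: ereal_sup_ubound; exists m => //=.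
  rewrite card_box -/c; congr (_ * _)%E; apply: eq_integral => w _.
  by rewrite /box_sum fsbig_finite//; exact: finite_box.
move=> h; rewrite -natrX -/c expr2 [r / c]mulrC EFinM EFinM -muleA.
by rewrite lee_wpmul2l// lee_fin invr_ge0.
Qed.

Lemma calN_ge0 : 0 <= r.
Proof.
rewrite -lee_fin; apply: le_trans calN_r.
apply: (@le_trans _ _ _ _ _ _ (ereal_sup_ubound _)); last by exists 0%N.
by rewrite mule_ge0 ?lee_fin ?invr_ge0// integral_ge0// => w _; rewrite lee_fin sqr_ge0.
Qed.

(** The box of radius 0 in the supremum; it starts the iteration. *)
Lemma sqnorm_le_calN : (V f <= r%:E)%E.
Proof.
have := sqnorm_box_avg 0; rewrite muln0 expr1n divr1; apply: le_trans.
rewrite /avgB muln0 exp1n invr1.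
rewrite [X in (_ <= sqnorm P X)%E](_ : _ = f)//; apply/funext => w; rewrite mul1r.
have -> : B 0 = [fset (0 : Zd d)]%fset.
  rewrite /B (_ : box d 0 = [set` [fset (0 : Zd d)]%fset]) ?set_fsetK//.
  apply/seteqP; split=> [x /= x0|x /=]; rewrite inE.
    by apply/eqP/rowP => i; rewrite mxE; have := x0 i => /=; lia.
  by move=> /eqP -> i; rewrite mxE; lia.
by rewrite big_seq_fset1 env_shift0.
Qed.

(* [L^(4n) f] is its average over a box, whose size is controlled by [calN],
   plus an average of increments of [L^(3n) (L^n f)], which are small compared
   with [L^n f] as soon as the box is small compared with [sqrt n]. *)
Lemma sqnorm_iter_lazy_rec n m (b : R) : (V (iter n L f) <= b%:E)%E ->
  (V (iter (4 * n) L f) <=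
    (2 * (r / (2 * m).+1%:R ^+ d) +
     2 * ((d * m)%:R ^+ 2 * ((4 * d%:R + 2) / (3 * n).+1%:R * b)))%:E)%E.
Proof.
move=> nb.
set g := iter n L f in nb; have mg : measurable_fun setT g by exact: measurable_iter_lazy.
have gE : iter (4 * n) L f = iter (3 * n) L g.
  by rewrite /g -iterD; congr iter; lia.
set h := iter (3 * n) L g.
have mh : measurable_fun setT h by exact: measurable_iter_lazy.
pose u x w := h w - h (env_shift x w).
have mu x : measurable_fun setT (u x).
  by apply: measurable_funB => //; exact: measurable_comp_shift.
(* [L] commutes with translations, so the box average of [h] equals [L^(4n)] of the box average of
   [f]; in this order contraction and [sqnorm_box_avg] apply directly. *)
have split_h : h = (fun w => iter (4 * n) L (avgB m f) w +
    ((2 * m).+1 ^ d)%:R^-1 * \sum_(x <- B m) u x w).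
  apply/funext => w; rewrite iter_avg_scale_sum.
  under eq_bigr do rewrite iter_lazy_shift gE -/h.
  rewrite -mulrDr -big_split/=; under eq_bigr do rewrite addrC subrK.
  rewrite big_const_seq count_predT sizeB iter_addr addr0 -[h w *+ _]mulr_natr.
  by rewrite mulrCA mulVf ?mulr1// gt_eqF.
rewrite gE -/h split_h.
set b1 := r / _; set b2 := _ ^+ 2 * _.
have -> : 2 * b1 + 2 * b2 = (1 + 1) * b1 + (1 + 1^-1) * b2 by rewrite invr1.
apply: sqnormD_le => //.
- apply: measurable_iter_lazy; apply: measurable_funM => //.
  by apply: measurable_sum => x; exact: measurable_comp_shift.
- by apply: measurable_funM => //; exact: measurable_sum.
- apply: le_trans (sqnorm_box_avg m); apply: sqnorm_iter_lazy_le.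
  apply: measurable_funM => //.
  by apply: measurable_sum => x; exact: measurable_comp_shift.
rewrite sqnormZ; last exact: measurable_sum.
set c := ((2 * m).+1 ^ d)%:R : R; have c0 : 0 < c by exact: cardB_gt0.
have -> : b2 = c^-1 ^+ 2 * (c ^+ 2 * b2).
  by rewrite mulrA -exprMn mulVf ?expr1n ?mul1r// gt_eqF.
rewrite [leRHS]EFinM lee_wpmul2l ?lee_fin ?sqr_ge0// /c -(sizeB m).
apply: sqnorm_sum_le => // x; rewrite in_fset_set ?inE; last exact: finite_box.
move=> /box_path[s [sm ->]].
have key e : (V (fun w => h (env_shift (unit_vec e) w) - h w)%R <=
    ((4 * d%:R + 2) / (3 * n).+1%:R * b)%:E)%E by exact: sqnorm_iter_lazy_diff.
have b0 : 0 <= b by rewrite -lee_fin; apply: le_trans nb; exact: sqnorm_ge0.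
apply: (@le_trans _ _ ((size s)%:R ^+ 2 * ((4 * d%:R + 2) / (3 * n).+1%:R * b))%:E).
  apply: le_trans (sqnorm_shift_path _ _ s mh key); rewrite /sqnorm le_eqVlt.
  by apply/orP; left; apply/eqP; apply: eq_integral => w _; rewrite /u -sqrrN opprB.
rewrite lee_fin /b2 ler_wpM2r//.
  by rewrite mulr_ge0// divr_ge0// addr_ge0// mulr_ge0.
by rewrite ler_sqr ?nnegrE// ler_nat.
Qed.

(** At time [n = c * 4^k] with box radius [m = 2^k], this value bounds the factor
    [(d m)^2 (4 d + 2) / (3 n + 1)] of the increment term by [2^(-d) / 6]. *)
Let c := (2 ^ d.+1 * d ^ 2 * (4 * d + 2))%N.

Let c_gt0 : (0 < c)%N.
Proof. by rewrite /c !muln_gt0 !expn_gt0 d_gt0/=; lia. Qed.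

(** The constant 4 reproduces itself: a box of radius [2^k] has side larger than [2^(k+1)], so each
    of the two terms of the recursion is at most [2 r / (2^(k+1))^d]. *)
Lemma sqnorm_iter_lazy_pow4 k :
  (V (iter (c * 4 ^ k) L f) <= (4 * r / (2 ^ k)%:R ^+ d)%:E)%E.
Proof.
elim: k => [|k IH].
  apply: le_trans (sqnorm_iter_lazy_le _ _ mf) _.
  apply: le_trans sqnorm_le_calN _; rewrite lee_fin expr1n divr1.
  by have := calN_ge0; lra.
have := sqnorm_iter_lazy_rec _ (2 ^ k) _ IH.
rewrite mulnCA -expnS => /le_trans; apply; rewrite lee_fin.
set q := (2 ^ k)%:R : R; have q0 : 0 < q by rewrite ltr0n expn_gt0.
have r0 := calN_ge0.
have qd : 0 < q ^+ d by rewrite exprn_gt0.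
have two_d : 0 < 2 ^+ d :> R by rewrite exprn_gt0.
have -> : (2 ^ k.+1)%:R ^+ d = 2 ^+ d * q ^+ d :> R.
  by rewrite expnS natrM exprMn.
have h1 : r / (2 * 2 ^ k).+1%:R ^+ d <= r / (2 ^+ d * q ^+ d).
  rewrite ler_wpM2l// lef_pV2 ?posrE ?mulr_gt0 ?exprn_gt0//.
  by rewrite -exprMn lerXn2r ?nnegrE// -?natrM ?ler_nat// /q -natrM ler0n.
set e := (4 * d%:R + 2) : R.
have h2 : (d * 2 ^ k)%:R ^+ 2 * (e / (3 * (c * 4 ^ k)).+1%:R * (4 * r / q ^+ d))
    <= r / (2 ^+ d * q ^+ d).
  have d0 : 0 < d%:R :> R by rewrite ltr0n.
  have e0 : 0 < e by rewrite /e addr_gt0// mulr_gt0.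
  have cE : c%:R = 2 * 2 ^+ d * d%:R ^+ 2 * e.
    have -> : c%:R = (2 ^ d.+1)%:R * (d ^ 2)%:R * (4 * d + 2)%:R :> R.
      by rewrite -!natrM.
    by rewrite !natrX natrD natrM exprS.
  have q2 : (4 ^ k)%:R = q ^+ 2 by rewrite /q -natrX -expnM mulnC expnM.
  rewrite -natr1 (natrM _ 3) (natrM _ c) (natrM _ d) q2 cE -/q.
  set D := _ + 1; have D0 : 0 < D.
    by rewrite ltr_pwDr// mulr_ge0// !mulr_ge0// ltW.
  rewrite [leLHS](_ : _ = (4 * d%:R ^+ 2 * q ^+ 2 * e / D) * (r / q ^+ d)); last first.
    by field; rewrite !gt_eqF.
  rewrite [leRHS](_ : _ = (2 ^+ d)^-1 * (r / q ^+ d)); last first.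
    by rewrite invfM mulrCA.
  rewrite ler_wpM2r//; first by rewrite divr_ge0// ltW.
  rewrite ler_pdivrMr// ler_pdivlMl// /D.
  have : 0 < d%:R ^+ 2 * q ^+ 2 * e * 2 ^+ d by rewrite !mulr_gt0 ?exprn_gt0.
  set z := d%:R ^+ 2 * q ^+ 2 * e * 2 ^+ d => z0.
  rewrite [leLHS](_ : _ = 4 * z); last by rewrite /z; ring.
  rewrite [X in _ <= X + 1](_ : _ = 6 * z); last by rewrite /z; ring.
  by lra.
set z := (2 ^+ d * q ^+ d : R) in h1 h2 *.
have -> : 4 * r / z = 2 * (r / z) + 2 * (r / z) by ring.
by rewrite lerD// ler_wpM2l.
Qed.

(** Interpolates between the times [c * 4^k]. With [q = 2^k], the quantity [x = (s / q)^d] satisfies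
    [x^2 <= C * y] for [y = (s^2 / (m + 1))^d], and [x <= (1 + x^2) / 2] trades the half-integer
    power of [m] for an integer one; nothing is lost in order when [s^2] is comparable to [m]. *)
Lemma sqnorm_iter_lazy_decay m (s : R) : 0 < s ->
  (V (iter m L f) <=
   (4 * (4 * c)%:R ^+ d * r / s ^+ d * (1 + (s ^+ 2 / m.+1%:R) ^+ d))%:E)%E.
Proof.
move=> s0.
(* The last scale [c * 4^k] not exceeding [m], or [k = 0] when [m < c]; contraction carries the
   bound on to time [m]. *)
have [k [mk Vk]] : exists k, (m < c * 4 ^ k.+1)%N /\
    (V (iter m L f) <= (4 * r / (2 ^ k)%:R ^+ d)%:E)%E.
  have [mc|cm] := ltnP m c.
    exists 0%N; split; first by rewrite expn1; lia.
    apply: le_trans (sqnorm_iter_lazy_le _ _ mf) _.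
    apply: le_trans sqnorm_le_calN _; rewrite lee_fin expr1n divr1.
    by have := calN_ge0; lra.
  have mc0 : (0 < m %/ c)%N by rewrite divn_gt0.
  exists (trunc_log 4 (m %/ c)); have /andP[k1 k2] := trunc_log_bounds (isT : 1 < 4)%N mc0.
  split; first by rewrite mulnC -ltn_divLR.
  apply: le_trans (sqnorm_iter_lazy_pow4 _).
  set n := (c * _)%N; have nm : (n <= m)%N.
    by rewrite /n mulnC -leq_divRL.
  rewrite -(subnK nm) iterD; apply: sqnorm_iter_lazy_le.
  exact: measurable_iter_lazy.
apply: le_trans Vk _; rewrite lee_fin.
set q := (2 ^ k)%:R : R; have q0 : 0 < q by rewrite ltr0n expn_gt0.
have r0 := calN_ge0.
set x := (s / q) ^+ d; have x0 : 0 <= x by rewrite exprn_ge0// divr_ge0// ltW.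
set y := (s ^+ 2 / m.+1%:R) ^+ d.
set C := (4 * c)%:R ^+ d : R.
have C1 : 1 <= C by rewrite exprn_ege1// ler1n muln_gt0 c_gt0.
have y0 : 0 <= y by rewrite exprn_ge0// divr_ge0// sqr_ge0.
have xy : x ^+ 2 <= C * y.
  rewrite /x /y /C -exprMn -exprM mulnC exprM lerXn2r ?nnegrE ?sqr_ge0//.
    by rewrite mulr_ge0// divr_ge0// sqr_ge0.
  rewrite expr_div_n mulrCA ler_wpM2l ?sqr_ge0//.
  rewrite ler_pdivlMr// mulrC ler_pdivrMr ?exprn_gt0//.
  rewrite /q -natrX -natrM ler_nat (leq_trans mk)//.
  by rewrite -expnM (mulnC k) (expnM 2 2) expnS mulnCA mulnA.
have -> : 4 * r / q ^+ d = 4 * r / s ^+ d * x.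
  by rewrite /x expr_div_n; field; rewrite !gt_eqF ?exprn_gt0.
have -> : 4 * C * r / s ^+ d * (1 + y) = 4 * r / s ^+ d * (C * (1 + y)) by ring.
rewrite ler_wpM2l; first by [].
  by rewrite divr_ge0 ?mulr_ge0// exprn_ge0// ltW.
by nra.
Qed.

End decay.

(** * Exponential and gamma laws *)

Section density.
Context {R : realType} {dT : measure_display} {T : measurableType dT}.
Variables (mu nu : {measure set T -> \bar R}) (g : T -> R).
Hypotheses (mg : measurable_fun setT g) (g_ge0 : forall x, 0 <= g x).
Hypothesis nuE : forall A, measurable A -> nu A = (\int[mu]_(x in A) (g x)%:E)%E.

Import HBNNSimple.

Let mEg (f : T -> R) : measurable_fun setT f ->
  measurable_fun setT (fun x => (f x * g x)%:E).
Proof. by move=> mf; apply/measurable_EFinP/measurable_funM. Qed.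

Let integral_nnsfun_density (f : {nnsfun T >-> R}) :
  (\int[nu]_x (f x)%:E = \int[mu]_x (f x * g x)%:E)%E.
Proof.
transitivity (\sum_(k \in range f) (k%:E * nu (f @^-1` [set k])))%E.
  by rewrite integralT_nnsfun sintegralE.
transitivity (\sum_(k \in range f)
    \int[mu]_x (k * \1_(f @^-1` [set k]) x * g x)%:E)%E.
  apply: eq_fsbigr => k; rewrite inE => -[y _ fy].
  rewrite nuE// integral_mkcond -ge0_integralZl//=.
  - apply: eq_integral => x _; rewrite patchE indicE.
    by case: ifPn => _ /=; rewrite ?mule0 ?mulr0 ?mul0r// mulr1 EFinM.
  - apply/(measurable_restrictT _ _).1 => //.
    exact/measurable_funTS/measurable_EFinP.
  - by move=> x _; rewrite patchE; case: ifPn => //; rewrite lee_fin.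
  - by rewrite lee_fin -fy.
rewrite -ge0_integral_fsum//.
- apply: eq_integral => x _; rewrite fsumEFin//.
  by rewrite [in RHS]fimfunE mulr_fsuml.
- by move=> k; apply: mEg; exact: measurable_funM.
- by move=> k x _; rewrite EFinM mule_ge0 ?nnfun_muleindic_ge0// lee_fin.
Qed.

Lemma ge0_integral_density (f : T -> \bar R) :
  measurable_fun setT f -> (forall x, 0 <= f x)%E ->
  (\int[nu]_x f x = \int[mu]_x (f x * (g x)%:E))%E.
Proof.
move=> mf f0; pose f_ := nnsfun_approx measurableT mf.
have f_nd x m n : (m <= n)%N -> f_ m x <= f_ n x.
  by move=> mn; exact/lefP/nd_nnsfun_approx.
have f_cvg x : (f_ n x)%:E @[n --> \oo] --> f x by exact: cvg_nnsfun_approx.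
transitivity (limn (fun n => \int[nu]_x (f_ n x)%:E)%E).
  rewrite -monotone_convergence//=.
  - by apply: eq_integral => x _; apply/esym/cvg_lim.
  - by move=> n; exact/measurable_EFinP.
  - by move=> n x _; rewrite lee_fin.
  - by move=> x _ m n mn; rewrite lee_fin f_nd.
under eq_fun do rewrite integral_nnsfun_density.
rewrite -monotone_convergence//=.
- apply: eq_integral => x _; apply/cvg_lim => //.
  under eq_fun do rewrite EFinM.
  by apply: cvgeZr => //; exact: f_cvg.
- by move=> n; exact: mEg.
- by move=> n x _; rewrite lee_fin mulr_ge0.
- by move=> x _ m n mn; rewrite lee_fin ler_wpM2r// f_nd.
Qed.

End density.

Lemma integral_deriv_horner {R : realType} (p : {poly R}) (a b : R) : a <= b ->
  (\int[lebesgue_measure]_(x in `[a, b]) (p^`()).[x]%:E =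
   (p.[b] - p.[a])%:E)%E.
Proof.
rewrite le_eqVlt => /predU1P[->|ab]; first by rewrite set_itv1 integral_set1 subrr.
rewrite (@continuous_FTC2 _ _ (horner p))//.
- by apply: continuous_subspaceT => x; exact: continuous_horner.
- split=> [x _||]; first exact: derivable_horner.
  + by apply: cvg_at_right_filter; exact: continuous_horner.
  + by apply: cvg_at_left_filter; exact: continuous_horner.
- by move=> x _; rewrite derivE.
Qed.

Section exponential.
Context {R : realType}.
Variable lam : R.
Hypothesis lam_gt0 : 0 < lam.
Local Notation RT := (measurableTypeR R).
Local Notation leb := (@lebesgue_measure R).

Definition expo : probability RT R :=
  exponential_distribution.exponential_distribution_exponential_prob__canonical__probability_measure_Probability
    lam_gt0.

Let pdf_ge0 x : 0 <= exponential_pdf lam x.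
Proof. exact: exponential_pdf_ge0 (ltW lam_gt0) x. Qed.

Lemma ge0_integral_expo (f : RT -> \bar R) :
  measurable_fun setT f -> (forall x, 0 <= f x)%E ->
  (\int[expo]_x f x = \int[leb]_x (f x * (exponential_pdf lam x)%:E))%E.
Proof.
move=> mf f0; apply: ge0_integral_density => //.
exact: measurable_exponential_pdf.
Qed.

Let continuous_expNM : continuous (fun z : R^o => - expR (- lam * z)).
Proof.
move=> z; apply: cvgN; apply: continuous_comp; last exact: continuous_expR.
by apply: continuousM => //; apply: (@continuousN _ R^o); exact: cst_continuous.
Qed.

Lemma expo_tail (t : R) :
  0 <= t -> expo `]t, +oo[%classic = (expR (- (lam * t)))%:E.
Proof.
move=> t0; rewrite /expo /= /exponential_prob.
have mpdf D : measurable_fun D (fun x => (exponential_pdf lam x)%:E).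
  apply/measurable_EFinP; apply: measurable_funTS.
  exact: measurable_exponential_pdf.
rewrite integral_itv_obnd_cbnd//.
rewrite (@ge0_continuous_FTC2y _ _ (fun x => - expR (- lam * x)) _ 0).
- by rewrite sub0e EFinN oppeK mulNr.
- by move=> x _.
- have := @within_continuous_exponential_pdf R lam; apply: continuous_subspaceW.
  by move=> x /=; rewrite !in_itv/= !andbT; exact: le_trans.
- rewrite -oppr0; apply: cvgN.
  rewrite (_ : (fun x => expR (- lam * x)) =
               (fun z => expR (- z)) \o (fun z => lam * z)); last first.
    by apply: eq_fun => x; rewrite mulNr.
  apply: (@cvg_comp _ _ _ _ _ _ (pinfty_nbhs R)); last exact: cvgr_expR.
  exact: gt0_cvgMry.
- by move=> x _; exact: ex_derive.
- by apply: cvg_at_right_filter; exact: continuous_expNM.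
- move=> x; rewrite in_itv/= andbT => tx.
  by apply: derive1_exponential_pdf; rewrite in_itv/= andbT (le_lt_trans t0).
Qed.

Lemma expo_le0 (t : R) : t <= 0 -> expo `]t, +oo[%classic = 1%E.
Proof.
move=> t0; apply/eqP; rewrite eq_le probability_le1//=.
have := expo_tail 0 (lexx 0); rewrite mulr0 oppr0 expR0 => <-.
apply: le_measure; rewrite ?inE//=.
by move=> x /=; rewrite !in_itv/= !andbT; exact: le_lt_trans.
Qed.


Let addT (z : RT * RT) : RT := z.1 + z.2.

Let measurable_addT : measurable_fun setT addT.
Proof. exact: measurable_funD measurable_fst measurable_snd. Qed.

HB.instance Definition _ := isMeasurableFun.Build _ _ _ _ addT measurable_addT.

(** The law of the [n]-th jump time, built by convolution because the case [n = 0] is a point mass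
    without density. *)
Fixpoint gamma_law (n : nat) : probability RT R :=
  if n is m.+1 then distribution (gamma_law m \x expo)%E addT
  else \d_(0 : RT).

(** For [k = 0] and up to the factor [expR (- (lam * t))], the probability that a jump at time
    [a <= t] is followed by a holding time lasting beyond [t]. The factor [expR (lam * a)] cancels
    the exponential density, leaving polynomial integrals. *)
Let power_exp (k : nat) (t a : R) : R :=
  if a <= t then expR (lam * a) * ((t - a) ^+ k / k`!%:R) else 0.

Let measurable_power_exp k t : measurable_fun setT (power_exp k t : RT -> R).
Proof.
apply: measurable_fun_if => //.
- exact: measurable_fun_ler.
- apply: measurable_funTS; apply: measurable_funM.
    by apply: measurableT_comp => //; exact: measurable_funM.
  apply: measurable_funM => //; apply: measurable_funX.
  exact: measurable_funB.
Qed.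

Let power_exp_ge0 k t a : 0 <= power_exp k t a.
Proof.
rewrite /power_exp; case: ifPn => // at_.
by rewrite mulr_ge0 ?expR_ge0// divr_ge0// exprn_ge0// subr_ge0.
Qed.

Let integral_power (k : nat) (b : R) : 0 <= b ->
  (\int[leb]_(x in `[0%R, b]) (lam * ((b - (x : R)) ^+ k / k`!%:R))%:E =
   (lam * (b ^+ k.+1 / k.+1`!%:R))%:E)%E.
Proof.
move=> b0; pose c := lam / k.+1`!%:R.
have := integral_deriv_horner (- c *: (b%:P - 'X) ^+ k.+1) 0 b b0.
rewrite !hornerZ !horner_exp !hornerE subrr subr0 expr0n/= mulr0 sub0r mulNr opprK.
move=> intE; transitivity (c * b ^+ k.+1)%:E; last by congr EFin; rewrite /c; ring.
rewrite -intE; apply: eq_integral => x _; congr EFin.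
have -> : (- c *: (b%:P - 'X) ^+ k.+1)^`() = (c * k.+1%:R) *: (b%:P - 'X) ^+ k.
  rewrite derivZ deriv_exp derivB derivC derivX sub0r mulN1r mulNrn scalerN.
  by rewrite scaleNr opprK -scaler_nat scalerA.
rewrite [RHS]hornerZ horner_exp hornerD hornerN hornerC hornerX.
rewrite /c factS natrM; field.
by rewrite pnatr_eq0 -lt0n fact_gt0 nat1r pnatr_eq0.
Qed.

(* This is what makes the family [power_exp k t] convenient: convolving with
   [expo] only shifts [k]. *)
Let integral_power_exp k t a :
  (\int[expo]_s (power_exp k t (a + s))%:E = (lam * power_exp k.+1 t a)%:E)%E.
Proof.
rewrite ge0_integral_expo; last 2 first.
- apply/measurable_EFinP.
  apply: (@measurableT_comp _ _ _ RT RT R (power_exp k t)) => //.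
  exact: (@measurable_funD _ RT R setT (fun=> a) (fun s : RT => s : R)).
- by move=> s; rewrite lee_fin.
rewrite {2}/power_exp; case: ifPn => [at_|ta]; last first.
  rewrite mulr0; apply: integral0_eq => s _.
  rewrite -EFinM; have [s0|s0] := leP 0 s.
    rewrite /power_exp ifF ?mul0r//; apply/negbTE.
    by rewrite -ltNge (@lt_le_trans _ _ a) ?lerDl// ltNge.
  by rewrite lt0_exponential_pdf ?mulr0.
have ta0 : 0 <= t - a by rewrite subr_ge0.
transitivity (\int[leb]_(s in `[0%R, (t - a)%R])
    ((expR (lam * a))%:E * (lam * ((t - a - (s : R)) ^+ k / k`!%:R))%:E))%E.
  rewrite [RHS]integral_mkcond; apply: eq_integral => s _.
  rewrite patchE mem_setE in_itv/=.
  have [s0|s0] /= := leP 0 s; last by rewrite lt0_exponential_pdf ?mule0.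
  rewrite /power_exp exponential_pdfE// lerBrDl.
  case: ifPn => _; last by rewrite mul0e.
  rewrite -!EFinM; congr EFin.
  rewrite mulrDr expRD mulNr expRN opprD addrA; field.
  by rewrite pnatr_eq0 -lt0n fact_gt0 gt_eqF ?expR_gt0.
rewrite ge0_integralZl_EFin//.
- by rewrite integral_power// -EFinM; congr EFin; ring.
- move=> s; rewrite /= in_itv/= => /andP[s0 st].
  rewrite lee_fin mulr_ge0 ?(ltW lam_gt0)// divr_ge0// exprn_ge0//.
  by rewrite subr_ge0.
- apply/measurable_EFinP/measurable_funTS; apply: measurable_funM => //.
  apply: measurable_funM => //; apply: measurable_funX.
  exact: measurable_funB.
Qed.

(** Only [k = 0] is needed in the end, but each convolution raises [k], so the induction must carry
    it. *)
Let integral_gamma_law n k t : 0 <= t ->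
  (\int[gamma_law n]_a (power_exp k t a)%:E =
   (lam ^+ n * (t ^+ (n + k) / (n + k)`!%:R))%:E)%E.
Proof.
move=> t0; elim: n k => [k|n IH k].
  rewrite integral_dirac//=; last first.
    by apply/measurable_EFinP.
  by rewrite diracT mul1e /power_exp t0 mulr0 expR0 subr0 !mul1r.
rewrite /= ge0_integral_distribution//; last 2 first.
- exact/measurable_EFinP.
- by move=> s; rewrite lee_fin.
rewrite fubini_tonelli1//; last 2 first.
- apply/measurable_EFinP; exact: measurableT_comp.
- by move=> s; rewrite lee_fin.
rewrite /fubini_F /=; under eq_integral do rewrite integral_power_exp.
under eq_integral do rewrite EFinM.
rewrite ge0_integralZl_EFin//.
- by rewrite IH -EFinM addnS -addSn exprS mulrA.
- by move=> s _; rewrite lee_fin.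
- exact/measurable_EFinP.
- exact: ltW.
Qed.

Definition straddle (t : R) : set (R * R) := [set z | z.1 <= t < z.1 + z.2].

Lemma gamma_law_poisson n t : 0 <= t ->
  ((gamma_law n \x expo) (straddle t) =
   ((lam * t) ^+ n / n`!%:R * expR (- (lam * t)))%:E)%E.
Proof.
move=> t0; rewrite /product_measure1.
transitivity (\int[gamma_law n]_a ((expR (- (lam * t)))%:E *
    (power_exp 0 t a)%:E))%E.
  apply: eq_integral => a _ /=.
  rewrite (_ : xsection _ a = if a <= t then `]t - a, +oo[%classic else set0); last first.
    apply/seteqP; split=> s; rewrite /xsection/= inE/=.
      by move=> /andP[-> ts]; rewrite /= in_itv/= andbT ltrBlDl.
    by case: ifPn => //= at_; rewrite in_itv/= andbT ltrBlDl /straddle/= at_.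
  rewrite -[LHS]/(expo _).
  rewrite /power_exp; case: ifPn => at_; last by rewrite measure0 mule0.
  rewrite expo_tail ?subr_ge0// -EFinM; congr EFin.
  by rewrite expr0 fact0 divr1 mulr1 -expRD mulrBr opprB addrC.
rewrite ge0_integralZl_EFin//.
- rewrite integral_gamma_law// -EFinM addn0 exprMn; congr EFin; ring.
- by move=> s _; rewrite lee_fin.
- exact/measurable_EFinP.
Qed.

End exponential.

(** * Holding times along a fixed path *)

(** Packages restricted, rescaled image laws as measures, so that uniqueness theorems for measures
    apply to them. *)
Lemma restricted_law {R : realType} (dW dT : measure_display)
    (W : measurableType dW) (T : measurableType dT)
    (Q : {measure set W -> \bar R}) (E : set W) (phi : W -> T) (c : R) :
  0 <= c -> measurable E -> measurable_fun setT phi ->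
  exists mu : {measure set T -> \bar R},
    forall C, mu C = (c%:E * Q (phi @^-1` C `&` E))%E.
Proof.
move=> c0 mE mphi.
by unshelve eexists (mscale (NngNum c0) (pushforward (mrestr Q mE) phi)).
Qed.

(** [jump_chain_law] speaks of nonnegative thresholds only, while the generating half-lines have
    arbitrary endpoints. *)
Lemma expo_max0 {R : realType} (lam : R) (lam_gt0 : 0 < lam) (x : R) :
  expo lam lam_gt0 `]x, +oo[%classic =
  expo lam lam_gt0 `]Num.max x 0, +oo[%classic.
Proof.
by have [x0|x0] := leP x 0; [rewrite !expo_le0|].
Qed.

Section path_law.
Context {R : realType} {d : nat} {dW : measure_display} {W : measurableType dW}.
Variables (Q : probability W R) (lam : R) (lam_gt0 : 0 < lam).
Variables (Y : nat -> W -> Zd d) (T : nat -> W -> R).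
Hypothesis Y_measurable : forall n y, measurable (Y n @^-1` [set y]).
Hypothesis T_measurable : forall n, measurable_fun setT (T n).
Hypothesis T_gt0 : forall n u, 0 < T n u.
Local Notation RT := (measurableTypeR R).
Local Notation J := (jump_time T).

Lemma measurable_jump_time n : measurable_fun setT (J n).
Proof. exact: measurable_sum. Qed.

Lemma jump_timeS n u : J n.+1 u = J n u + T n u.
Proof. by rewrite /jump_time big_ord_recr. Qed.

Variables (n : nat) (y : nat -> Zd d) (q : R).
Hypothesis q_gt0 : 0 < q.
Hypothesis path_law : forall t : nat -> R, (forall i, 0 <= t i) ->
  Q [set u | forall i, (i <= n)%N -> Y i u = y i /\ t i < T i u] =
  (q * \prod_(i < n.+1) expR (- (lam * t i)))%:E.

Let E m (t : nat -> R) : set W :=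
  [set u | forall i, (i <= n)%N -> Y i u = y i /\ ((m <= i)%N -> t i < T i u)].

Let measurable_E m t : measurable (E m t).
Proof.
rewrite (_ : E m t = \bigcap_i (if (i <= n)%N then Y i @^-1` [set y i] `&`
   (if (m <= i)%N then T i @^-1` `]t i, +oo[%classic else setT) else setT)).
  apply: bigcapT_measurable => i; case: ifPn => // _.
  apply: measurableI => //; case: ifPn => // _.
  by rewrite -[X in measurable X]setTI; apply: T_measurable.
apply/seteqP; split=> [u Eu i _|u Eu i ni].
  case: ifPn => // ni; have [Yi Ti] := Eu _ ni; split=> //.
  by case: ifPn => // mi; rewrite /= in_itv/= andbT Ti.
have := Eu i I; rewrite ni => -[Yi]; case: ifPn => // mi.
by rewrite /= in_itv/= andbT.
Qed.

Let K m (t : nat -> R) : R := q * \prod_(m <= i < n.+1) expR (- (lam * t i)).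

Let K_gt0 m t : 0 < K m t.
Proof. by rewrite mulr_gt0// prodr_gt0// => i _; exact: expR_gt0. Qed.

(* Times before [m] enter only through their sum [J m], the others keep their
   explicit tails; passing from [m] to [m.+1] replaces the tail of [T m] by its
   whole law, independent of [J m]. *)
Let marginal m := forall (t : nat -> R) (A : set RT), (forall i, 0 <= t i) ->
  measurable A ->
  Q (J m @^-1` A `&` E m t) = ((K m t)%:E * gamma_law lam lam_gt0 m A)%E.

Let joint m := forall (t : nat -> R) (C : set (RT * RT)), (forall i, 0 <= t i) ->
  measurable C ->
  Q ((fun u => (J m u, T m u)) @^-1` C `&` E m.+1 t) =
  ((K m.+1 t)%:E * (gamma_law lam lam_gt0 m \x expo lam lam_gt0) C)%E.

(** Two nested uniqueness arguments: rectangles determine the joint law, and for a fixed first side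
    [A] the half-lines determine the law of [T m]. On a half-line the event is again of the form
    covered by [marginal]. *)
Let joint_of_marginal m : (m <= n)%N -> marginal m -> joint m.
Proof.
move=> mn margm t C t0 mC.
have Kinv0 : 0 <= (K m.+1 t)^-1 by rewrite invr_ge0 ltW.
have KK z : ((K m.+1 t)^-1%:E * ((K m.+1 t)%:E * z) = z)%E.
  by rewrite muleA -EFinM mulVf ?mul1e// gt_eqF.
have mJT : measurable_fun setT (fun u => (J m u, T m u) : (RT * RT)%type).
  by apply: measurable_fun_pair; [exact: measurable_jump_time|exact: T_measurable].
have [mu muE] := restricted_law _ _ _ _ Q _ _ _ Kinv0 (measurable_E m.+1 t) mJT.
have key : (gamma_law lam lam_gt0 m \x expo lam lam_gt0)%E C = mu C.
  apply: product_measure_unique => // A B mA mB.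
  have mJA : measurable (J m @^-1` A).
    by rewrite -[X in measurable X]setTI; exact: measurable_jump_time.
  have [nu1 nu1E] := restricted_law _ _ _ RT Q _ _ _ Kinv0
    (measurableI _ _ mJA (measurable_E m.+1 t)) (T_measurable m).
  have [nu2 nu2E] : exists mu : {measure set RT -> \bar R}, forall C,
      mu C = (gamma_law lam lam_gt0 m A * expo lam lam_gt0 C)%E.
    have g0 : 0 <= fine (gamma_law lam lam_gt0 m A) by exact: fine_ge0.
    exists (mscale (NngNum g0) (expo lam lam_gt0)) => D.
    by rewrite -[in RHS](@fineK _ (gamma_law lam lam_gt0 m A)) ?fin_num_measure.
  have -> : mu (A `*` B) = nu1 B.
    rewrite muE nu1E; congr (_ * Q _)%E; rewrite setIA; congr (_ `&` _).
    by apply/seteqP; split=> u [].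
  rewrite -nu2E.
  apply: (@measure_unique _ R RT (@RGenOInfty.G R)
    (fun k => `](- k%:R : R), +oo[%classic)) => //.
  - exact: RGenOInfty.measurableE.
  - move=> _ _ [a ->] [b ->]; exists (Num.max a b).
    apply/seteqP; split=> x /=; rewrite !in_itv/= !andbT gt_max.
      by move=> [-> ->].
    by move=> /andP[].
  - by move=> i; exists (- i%:R).
  - apply/seteqP; split=> // x _; exists (Num.truncn `|x|).+1 => //=.
    rewrite in_itv/= andbT ltrNl (le_lt_trans (ler_norm _))// normrN.
    exact: truncnS_gt.
  - move=> _ [x ->]; rewrite nu1E nu2E expo_max0.
    set x' := Num.max x 0; have x'0 : 0 <= x' by rewrite le_max lexx orbT.
    (* Raising the threshold at index [m] to [x'] absorbs the event [x < T m u] into [E m t'];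
       positivity of [T m] takes care of negative [x]. *)
    pose t' i := if i == m then x' else t i.
    have t'0 i : 0 <= t' i by rewrite /t'; case: ifP.
    transitivity ((K m.+1 t)^-1%:E * Q (J m @^-1` A `&` E m t'))%E.
      congr (_ * Q _)%E; rewrite setICA; congr (_ `&` _).
      apply/seteqP; split=> u.
        move=> [/= ]; rewrite in_itv/= andbT => xT Eu i ni.
        have [Yi Ti] := Eu i ni; split=> //; rewrite leq_eqVlt /t'.
        case: eqVneq => [<- _|_ /=]; last exact: Ti.
        by rewrite /x' gt_max xT T_gt0.
      move=> Eu; split.
        have [_ /(_ (leqnn m))] := Eu _ mn; rewrite /t' eqxx /x' gt_max => /andP[xT _].
        by rewrite /= in_itv/= andbT.
      move=> i ni; have [Yi Ti] := Eu i ni; split=> // mi.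
      by have := Ti (ltnW mi); rewrite /t' gtn_eqF.
    rewrite margm// expo_tail// -[RHS]KK; congr (_ * _)%E.
    rewrite [RHS]muleC -muleA [LHS]muleC; congr (_ * _)%E.
    rewrite -EFinM; congr EFin; rewrite /K big_ltn// {1}/t' eqxx.
    rewrite mulrCA; congr (_ * (_ * _)).
    by apply: eq_big_nat => i /andP[mi _]; rewrite /t' gtn_eqF.
  - move=> k; rewrite nu1E ltey_eq fin_numM// fin_num_measure//.
    apply: measurableI; last exact: measurableI.
    by rewrite -[X in measurable X]setTI; exact: T_measurable.
by rewrite key muE muleA -EFinM mulfV ?mul1e// gt_eqF.
Qed.

Let marginalP m : (m <= n)%N -> marginal m.
Proof.
elim: m => [_ t A t0 mA|m IH mn t A t0 mA].
  have J0 u : J 0 u = 0 by rewrite /jump_time big_ord0.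
  have E0 : Q (E 0 t) = (K 0 t)%:E.
    rewrite /K big_mkord -path_law//; congr (Q _).
    by apply/seteqP; split=> u Eu i ni; have [Yi Ti] := Eu i ni; split=> //;
      exact: Ti.
  rewrite /= diracE; have [A0|A0] := boolP ((0 : R) \in A).
    rewrite mule1 -E0; congr (Q _); apply/seteqP; split=> [u []//|u Eu].
    by split=> //=; rewrite J0 -[A _]/(A _) -in_setE.
  rewrite mule0 (_ : _ `&` _ = set0) ?measure0//.
  apply/seteqP; split=> // u [/=]; rewrite J0 => A0' _.
  by move: A0; rewrite notin_setE.
have := joint_of_marginal m (ltnW mn) (IH (ltnW mn)).
move=> /(_ t ((fun z : RT * RT => (z.1 : R) + (z.2 : R) : RT) @^-1` A) t0).
have mC : measurable ((fun z : RT * RT => (z.1 : R) + (z.2 : R) : RT) @^-1` A).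
  rewrite -[X in measurable X]setTI.
  by apply: (@measurable_funD _ (RT * RT)%type R setT fst snd).
move=> /(_ mC) jm; rewrite /= /distribution /pushforward /=.
rewrite -[RHS]jm; congr (Q _); apply/seteqP; split=> u [] /=;
  by rewrite jump_timeS.
Qed.

(** The case [m = n] of the joint law: no threshold is left in [E n.+1], only the path condition. *)
Lemma path_straddle_law (t : R) : 0 <= t ->
  Q [set u | (forall i, (i <= n)%N -> Y i u = y i) /\ J n u <= t < J n.+1 u] =
  (q * ((lam * t) ^+ n / n`!%:R * expR (- (lam * t))))%:E.
Proof.
move=> t0; have := joint_of_marginal n (leqnn n) (marginalP n (leqnn n)) (fun=> 0)
  (straddle t) (fun=> lexx 0).
have mS : measurable (straddle t : set (RT * RT)).
  rewrite (_ : straddle t = (fst @^-1` `]-oo, t]%classic) `&`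
     ((fun z => z.1 + z.2) @^-1` `]t, +oo[%classic)); last first.
    apply/seteqP; split=> z; rewrite /straddle /= !in_itv/= andbT.
      by move=> /andP[].
    by move=> [-> ->].
  apply: measurableI; rewrite -[X in measurable X]setTI.
    exact: (@measurable_fst _ _ RT RT).
  by apply: (@measurable_funD _ (RT * RT)%type R setT fst snd).
move=> /(_ mS); rewrite gamma_law_poisson// /K big_geq// mulr1 -EFinM => <-.
congr (Q _); apply/seteqP; split=> u.
  by move=> [Yu Ju]; split; [rewrite /= /straddle/= -jump_timeS|
    move=> i ni; split; [exact: Yu|rewrite ltnNge ni]].
move=> [/= Ju Eu]; split; last by rewrite jump_timeS.
by move=> i ni; have [] := Eu i ni.
Qed.

End path_law.

(** * Law of the simple random walk *)

Section simple_walk.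
Context {R : realType} {d : nat}.
Local Notation D := ('I_d * bool)%type.

Lemma unit_vecE (e : D) i : unit_vec e 0 i = (-1) ^+ e.2 * (i == e.1)%:R.
Proof. by rewrite !mxE eqxx. Qed.

Lemma unit_vec_inj : injective (@unit_vec d).
Proof.
move=> [i b] [j c] /rowP ij; have := ij i; rewrite !unit_vecE/= eqxx.
case: eqVneq => [<-|_]; last by case: b {ij}; rewrite mulr1 mulr0.
by rewrite !mulr1; case: b {ij}; case: c.
Qed.

Lemma neighbours_unit_vec (x y : Zd d) :
  neighbours x y <-> exists e : D, y = x + unit_vec e.
Proof.
split=> [xy|[e ->]]; last first.
  rewrite /neighbours (bigD1 e.1)//= big1 ?addr0 => [|i ie].
    by rewrite mxE unit_vecE eqxx mulr1 opprD addNKr sqrrN sqrr_sign.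
  by rewrite mxE unit_vecE (negPf ie) mulr0 addr0 subrr expr0n.
have [i zi] : exists i, x 0 i != y 0 i.
  apply/existsP; rewrite -negb_forall; apply/negP => /forallP xy0.
  move: xy; rewrite /neighbours big1// => i _.
  by rewrite (eqP (xy0 i)) subrr expr0n.
move: xy; rewrite /neighbours (bigD1 i)//=.
set S := \sum_(j < d | _) _ => xy.
have S0 : 0 <= S by rewrite sumr_ge0// => j _; exact: sqr_ge0.
have yx : (y 0 i - x 0 i) = 1 \/ (y 0 i - x 0 i) = -1.
  have : x 0 i - y 0 i != 0 by rewrite subr_eq0.
  by move: (x 0 i) (y 0 i) S0 xy {zi} => a b; nia.
have {}S0 : S = 0 by move: xy; case: yx => h; rewrite -sqrrN opprB h; lia.
have yxj j : j != i -> y 0 j = x 0 j.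
  move=> ji; move/eqP: S0; rewrite psumr_eq0 => [/allP/(_ j)|k _]; last exact: sqr_ge0.
  rewrite mem_index_enum ji /= sqrf_eq0 subr_eq0 => /(_ isT)/eqP.
  exact: esym.
case: yx => yx; [exists (i, false)|exists (i, true)]; apply/rowP => j;
  rewrite mxE unit_vecE/=; case: eqVneq => [->|/yxj ->]; rewrite ?mulr0 ?addr0//;
  lia.
Qed.

Lemma neighbours_fset (x : Zd d) :
  [set y | neighbours x y] = [set` [fset (x + unit_vec e)%R | e : D]%fset].
Proof.
apply/seteqP; split=> y /=.
  by move=> /neighbours_unit_vec[e ->]; apply/imfsetP; exists e.
by move=> /imfsetP[e _ ->]; apply/neighbours_unit_vec; exists e.
Qed.

Let w1 : env R d := fun=> 1%:pos.

Lemma conductance1 (x : Zd d) (e : D) : conductance w1 x (x + unit_vec e) = 1.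
Proof.
rewrite /conductance; case: pselect => // nxy; case: nxy.
by apply/neighbours_unit_vec; exists e.
Qed.

Lemma total_rate1 (x : Zd d) : total_rate w1 x = 2 * d%:R.
Proof.
rewrite /total_rate neighbours_fset fsbig_finite; last exact: finite_fset.
rewrite set_fsetK big_imfset/=; last by move=> e e' _ _ /addrI /unit_vec_inj.
rewrite big_enum/=; under eq_bigr do rewrite conductance1.
by rewrite sumr_const card_prod card_ord card_bool natrM mulrC.
Qed.

Fixpoint words (n : nat) : seq (seq D) :=
  if n is m.+1 then [seq e :: s | e <- enum {: D}, s <- words m] else [:: [::]].

Lemma size_words n s : s \in words n -> size s = n.
Proof.
elim: n s => [|n IH] s /=; first by rewrite inE => /eqP ->.
by move=> /allpairsP[[e s'] [_ /IH <- ->]].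
Qed.

Lemma words_uniq n : uniq (words n).
Proof.
elim: n => [//|n IH] /=; apply: allpairs_uniq => //; first exact: enum_uniq.
by move=> [e s] [e' s'] _ _ /= [-> ->].
Qed.

Lemma big_words n (F : seq D -> R) :
  \sum_(s <- words n.+1) F s = \sum_e \sum_(s <- words n) F (e :: s).
Proof. by rewrite /= big_allpairs_dep/= big_enum. Qed.

Definition walk_step : (Zd d -> R) -> Zd d -> R :=
  avg (fun _ : D => (2 * d%:R)^-1) (fun e x => x + unit_vec e).

Lemma iter_walk_step n (h : Zd d -> R) x :
  iter n walk_step h x =
  (2 * d%:R)^-1 ^+ n * \sum_(s <- words n) h (x + \sum_(e <- s) unit_vec e).
Proof.
elim: n x => [|n IH] x; first by rewrite big_seq1 big_nil addr0 mul1r.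
rewrite iterS {1}/walk_step /avg big_words exprS -mulrA mulr_sumr mulr_sumr.
apply: eq_bigr => e _; rewrite IH; congr (_ * (_ * _)).
by apply: eq_bigr => s _; rewrite big_cons addrA.
Qed.

Definition pos (s : seq D) (i : nat) : Zd d := \sum_(e <- take i s) unit_vec e.

Lemma posS s i e : (i < size s)%N -> pos s i.+1 = pos s i + unit_vec (nth e s i).
Proof. by move=> ?; rewrite /pos (take_nth e)// -cats1 big_cat/= big_seq1. Qed.

(** Makes the events attached to distinct words disjoint. *)
Lemma pos_inj n s s' : size s = n -> size s' = n ->
  (forall i, (i <= n)%N -> pos s i = pos s' i) -> s = s'.
Proof.
move=> sn s'n ss'; case: s sn ss' => [|e s] sn ss'.
  by apply/esym/nilP; rewrite /nilp s'n -sn.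
apply: (@eq_from_nth _ e) => [|i]; first by rewrite sn s'n.
rewrite sn => i_n; apply/unit_vec_inj/(@addrI _ (pos (e :: s) i)).
rewrite -posS ?sn// ss'// (posS _ _ e) ?s'n//; congr (_ + _).
by rewrite ss'// ltnW.
Qed.

End simple_walk.

Lemma measurable_countable_comp {R : realType} {dW : measure_display}
    {W : measurableType dW} {I : countType} (Z : W -> I) (h : I -> R) :
  (forall x, measurable (Z @^-1` [set x])) -> measurable_fun setT (h \o Z).
Proof.
move=> mZ _ B mB; rewrite setTI.
rewrite (_ : _ @^-1` B = \bigcup_x (if h x \in B then Z @^-1` [set x] else set0)).
  by apply: countable_bigcupT_measurable => // x; case: ifP.
apply/seteqP; split=> u /=.
  by move=> Bu; exists (Z u) => //; rewrite mem_set.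
by move=> [x _]; case: ifPn => //; rewrite inE => Bx /= ->.
Qed.

Lemma poisson_pmf_sum1 {R : realType} (r : R) : 0 < r ->
  (\sum_(k <oo) (poisson_pmf r k)%:E = 1)%E.
Proof.
move=> r0; transitivity (\esum_(k in [set: nat]) (poisson_pmf r k)%:E)%E.
  by rewrite nneseries_esumT// => k; rewrite lee_fin poisson_pmf_ge0.
have : (poisson_prob r 0%N : set nat -> \bar R) setT = 1%E.
  exact: probability_setT.
by rewrite /poisson_prob r0.
Qed.

(** * Poisson number of jumps and its thinning *)

Section simple_walk_law.
Context {R : realType} {d : nat} {dW : measure_display} {W : measurableType dW}.
Variables (Q : probability W R) (X : R -> W -> Zd d).
Hypotheses (d_gt0 : (0 < d)%N) (hX : simple_walk Q X).
Local Notation D := ('I_d * bool)%type.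

Let X_measurable t x : measurable (X t @^-1` [set x]).
Proof. by case: hX. Qed.

Let lam : R := 2 * d%:R.

Let lam_gt0 : 0 < lam.
Proof. by rewrite mulr_gt0// ltr0n. Qed.

Lemma measurable_walk (h : Zd d -> R) t :
  measurable_fun setT (fun u => (h (X t u))%:E).
Proof. by apply/measurable_EFinP; apply: (measurable_countable_comp (X t)). Qed.

(** Decomposes the space by the number [n] of jumps before [t] and the word [s] of steps made; each
    such event has probability [lam^(-n)] times a Poisson weight. *)
Lemma ge0_integral_walk (h : Zd d -> R) (t : R) :
  (forall x, 0 <= h x) -> 0 < t ->
  (\int[Q]_u (h (X t u))%:E =
   \sum_(n <oo) (poisson_pmf (lam * t) n * iter n walk_step h 0)%:E)%E.
Proof.
move=> + t0; case: hX => _ [Y [T [[mY mT T0 YT_law] XY]]].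
have lt0 : 0 < lam * t by rewrite mulr_gt0.
pose J n u := jump_time T n u.
pose G n (s : seq D) := [set u | (forall i, (i <= n)%N -> Y i u = pos s i) /\
  J n u <= t < J n.+1 u].
have QG n s : size s = n -> Q (G n s) = (lam^-1 ^+ n * poisson_pmf (lam * t) n)%:E.
  move=> sn; rewrite /poisson_pmf lt0.
  apply: (path_straddle_law Q lam lam_gt0 Y T mY mT T0 n (pos s)) => //; last exact: ltW.
    by rewrite exprn_gt0// invr_gt0.
  move=> tt tt0; rewrite YT_law//; congr EFin.
  rewrite {1}/pos take0 big_nil eqxx mul1r; congr (_ * _); last first.
    by apply: eq_bigr => i _; rewrite total_rate1.
  rewrite (eq_bigr (fun=> lam^-1)) ?prodr_const ?card_ord// => i _.
  rewrite total_rate1; case: s sn => [|e s] sn; first by case: i => i; rewrite -sn.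
  by rewrite (posS _ _ e) ?sn// conductance1 mul1r.
have mJ n : measurable_fun setT (J n) by exact: measurable_jump_time.
have mG n s : measurable (G n s).
  rewrite (_ : G n s = (\bigcap_i (if (i <= n)%N then Y i @^-1` [set pos s i] else setT))
    `&` (J n @^-1` `]-oo, t]%classic `&` J n.+1 @^-1` `]t, +oo[%classic)).
    apply: measurableI; first by apply: bigcapT_measurable => i; case: ifP.
    by apply: measurableI; rewrite -[X in measurable X]setTI; exact: mJ.
  apply/seteqP; split=> u /=; rewrite !in_itv/= andbT.
    move=> [Yu /andP[-> ->]]; split=> // i _; case: ifPn => // /Yu.
    by [].
  move=> [Yu [J1 J2]]; split=> [i ni|]; last by rewrite J1.
  by have := Yu i I; rewrite ni.
have JS n u : J n u < J n.+1 u by rewrite /J jump_timeS ltrDl.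
have Jle m n u : (m <= n)%N -> J m u <= J n u.
  move=> /subnK <-; elim: (n - m)%N => [//|k IH].
  by rewrite addSn (le_trans IH)// ltW.
pose F n := \big[setU/set0]_(s <- words n) G n s.
have mF n : measurable (F n) by apply: bigsetU_measurable => s _.
have FE n u : F n u <-> exists2 s, s \in words n & G n s u.
  by rewrite /F -bigcup_seq; split=> [[s]|[s]]; exists s.
have tG n : trivIset [set` words n] (G n).
  move=> s s' /= sn s'n [u [[Yu _] [Yu' _]]].
  apply: (pos_inj n) => [||i ni]; [exact: size_words|exact: size_words|].
  by rewrite -Yu// -Yu'.
have tF : trivIset setT F.
  apply: ltn_trivIset => m n mn; apply/seteqP; split=> // u.
  move=> [/FE[s _ [_ /andP[_ Jm]]] /FE[s' _ [_ /andP[Jn _]]]].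
  by have := Jle _ _ u mn; rewrite leNgt (le_lt_trans Jn).
have intF (g : Zd d -> R) n : (forall x, 0 <= g x) ->
    (\int[Q]_(u in F n) (g (X t u))%:E =
     (poisson_pmf (lam * t) n * iter n walk_step g 0)%:E)%E.
  move=> g0; rewrite ge0_integral_bigsetU//; last 3 first.
  - exact: words_uniq.
  - exact/measurable_funTS/measurable_walk.
  - by move=> u _; rewrite lee_fin.
  rewrite iter_walk_step -/lam mulrCA mulr_sumr mulr_sumr -sumEFin.
  rewrite big_seq [RHS]big_seq; apply: eq_bigr => s /size_words sn.
  transitivity (\int[Q]_(u in G n s) (cst (g (pos s n))%:E u))%E.
    apply: eq_integral => u; rewrite inE => -[Yu Ju].
    by rewrite (XY n)// Yu.
  transitivity ((g (pos s n))%:E * Q (G n s))%E; first exact: integral_cst.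
  rewrite QG// -EFinM /pos -sn take_size add0r.
  by congr EFin; ring.
have mUF : measurable (\bigcup_n F n) by exact: bigcup_measurable.
have intUF (g : Zd d -> R) : (forall x, 0 <= g x) ->
    (\int[Q]_(u in \bigcup_n F n) (g (X t u))%:E =
     \sum_(n <oo) (poisson_pmf (lam * t) n * iter n walk_step g 0)%:E)%E.
  move=> g0; rewrite ge0_integral_bigcup//; last 2 first.
  - exact/measurable_funTS/measurable_walk.
  - by move=> u _; rewrite lee_fin.
  by apply: eq_eseriesr => n _; exact: intF.
(* The formula for the constant 1 shows that the events carry full mass, because the Poisson weights
   sum to 1. Their complement, where the value of [X t] is not controlled, is thus negligible. *)
have QF : Q (\bigcup_n F n) = 1%E.
  have := intUF (fun=> 1) (fun=> ler01); rewrite integral_cst// mul1e => ->.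
  rewrite -(poisson_pmf_sum1 _ lt0); apply: eq_eseriesr => n _.
  congr EFin; rewrite (_ : iter n walk_step _ 0 = 1) ?mulr1//.
  elim: n (0 : Zd d) => [//|n IH] x; rewrite iterS /walk_step /avg.
  under eq_bigr do rewrite IH mulr1.
  rewrite sumr_const card_prod card_ord card_bool -[_ *+ _]mulr_natr natrM.
  by rewrite mulrC [d%:R * _]mulrC mulfV// gt_eqF.
have QN : Q (~` \bigcup_n F n) = 0%E by rewrite probability_setC// QF subee.
move=> h0; rewrite (@ge0_negligible_integral _ _ _ _ _ (~` \bigcup_n F n))//.
- by rewrite setDE setCK setTI intUF.
- exact: measurableC.
- exact: measurable_walk.
- by move=> u _; rewrite lee_fin.
Qed.

Lemma iter_lazy_binomial (h : Zd d -> R) m x :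
  iter m (lazy (Zd d) (fun v x => x + v)) h x =
  \sum_(n < m.+1) 'C(m, n)%:R / 2 ^+ m * iter n walk_step h x.
Proof.
have lazyE (g : Zd d -> R) y :
    lazy (Zd d) (fun v x => x + v) g y = (g y + walk_step g y) / 2.
  rewrite /lazy /avg big_option/= /walk_step /avg [RHS]mulrC mulrDr.
  congr (_ + _); rewrite mulr_sumr; apply: eq_bigr => e _.
  by rewrite mulrA -invfM; congr (_^-1 * _); ring.
elim: m x => [|m IH] x; first by rewrite big_ord1 bin0 expr0 divr1 mul1r.
rewrite iterS lazyE IH.
have -> : walk_step (iter m (lazy (Zd d) (fun v x => x + v)) h) x =
    \sum_(n < m.+1) 'C(m, n)%:R / 2 ^+ m * iter n.+1 walk_step h x.
  rewrite {1}/walk_step /avg; under eq_bigr do rewrite IH mulr_sumr.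
  rewrite exchange_big; apply: eq_bigr => n _ /=.
  by rewrite /walk_step /avg mulr_sumr; apply: eq_bigr => e _; rewrite mulrCA.
pose a n := iter n walk_step h x.
transitivity ((1 / 2 ^+ m * a 0 + \sum_(n < m.+1) 'C(m, n.+1)%:R / 2 ^+ m * a n.+1
    + \sum_(n < m.+1) 'C(m, n)%:R / 2 ^+ m * a n.+1) / 2).
  congr ((_ + _) / 2); rewrite big_ord_recl bin0; congr (_ + _).
  by rewrite [in RHS]big_ord_recr/= bin_small// 2!mul0r addr0.
rewrite [in RHS]big_ord_recl bin0 2!mulrDl -addrA !mulr_suml -big_split/=.
congr (_ + _); first by rewrite /a/= exprS invfM; ring.
apply: eq_bigr => n _; rewrite [bump _ _]add1n binS natrD exprS invfM.
by rewrite -[walk_step (iter (0 + n) _ _) x]/(a n.+1); ring.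
Qed.

(* Thinning: a Poisson([2 r]) number of lazy steps contains a Poisson([r])
   number of genuine ones. *)
Lemma poisson_lazy (h : Zd d -> R) (r : R) x : (forall x, 0 <= h x) -> 0 < r ->
  (\sum_(n <oo) (poisson_pmf r n * iter n walk_step h x)%:E =
   \sum_(m <oo) (poisson_pmf (2 * r) m *
     iter m (lazy (Zd d) (fun v x => x + v)) h x)%:E)%E.
Proof.
move=> h0 r0; have r20 : 0 < 2 * r by rewrite mulr_gt0.
have K0 n : 0 <= iter n walk_step h x.
  by apply: iter_avg_ge0 => // _; rewrite invr_ge0 ltW.
pose a m n := (poisson_pmf (2 * r) m * ('C(m, n)%:R / 2 ^+ m * iter n walk_step h x))%:E.
have a0 m n : (0 <= a m n)%E.
  by rewrite lee_fin mulr_ge0 ?poisson_pmf_ge0// mulr_ge0// divr_ge0// exprn_ge0.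
transitivity (\sum_(m <oo) \sum_(n <oo) a m n)%E; last first.
  apply: eq_eseriesr => m _; rewrite iter_lazy_binomial mulr_sumr -sumEFin.
  rewrite (nneseries_split 0 m.+1)// add0n [X in (_ + X)%E]eseries0 ?adde0.
    by rewrite big_mkord.
  by move=> n mn _; rewrite /a bin_small// 2!mul0r mulr0.
rewrite nneseries_interchange//; apply: eq_eseriesr => n _.
rewrite (nneseries_split 0 n)// add0n [X in (X + _)%E]big_nat_cond big1 ?add0e; last first.
  by move=> m /andP[/andP[_ mn] _]; rewrite /a bin_small// 2!mul0r mulr0.
rewrite -nneseries_addn//.
(* With [m = k + n], the Poisson weight of parameter [2 r] times the binomial weight factors as
   [poisson_pmf r n * poisson_pmf r k]; summing over [k] then gives 1. *)
under [in RHS]eq_eseriesr.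
  move=> k _; rewrite (_ : a (k + n)%N n =
    ((poisson_pmf r n * iter n walk_step h x)%:E * (poisson_pmf r k)%:E)%E); last first.
    rewrite /a -EFinM; congr EFin; rewrite /poisson_pmf r0 r20.
    have binE : 'C(k + n, n)%:R = (k + n)`!%:R / (n`!%:R * k`!%:R) :> R.
      apply: (@mulIf _ (n`!%:R * k`!%:R)); last first.
        rewrite divfK; first by rewrite -!natrM -{2}(addnK n k) bin_fact// leq_addl.
        by rewrite -natrM pnatr_eq0 -lt0n muln_gt0 !fact_gt0.
      by rewrite -natrM pnatr_eq0 -lt0n muln_gt0 !fact_gt0.
    rewrite binE (_ : - (2 * r) = - r + - r); last by ring.
    rewrite expRD exprMn !exprD; set c := (k + n)`!%:R.
    have c0 : c != 0 by rewrite pnatr_eq0 -lt0n fact_gt0.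
    field.
    by rewrite c0 !expf_neq0 ?pnatr_eq0// -?lt0n ?fact_gt0.
  over.
rewrite nneseriesZl; last by move=> k _; rewrite lee_fin poisson_pmf_ge0.
by rewrite poisson_pmf_sum1// mule1.
Qed.

End simple_walk_law.

(** * Conclusion *)

Section jensen.
Context {R : realType}.
Variable p : nat -> R.
Hypotheses (p_ge0 : forall n, 0 <= p n) (p_sum1 : (\sum_(n <oo) (p n)%:E = 1)%E).

(** Sums [2 x a <= x^2 + (a - b)^2 + 2 x b] with [x = A - B]. As [x >= 0] every term is nonnegative,
    so no difference of series is ever formed. *)
Let nneseries_sqr_le_half (a b : nat -> R) (A B : R) :
  (forall n, 0 <= a n) -> (forall n, 0 <= b n) -> B <= A ->
  (\sum_(n <oo) (p n * a n)%:E = A%:E)%E ->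
  (\sum_(n <oo) (p n * b n)%:E = B%:E)%E ->
  (((A - B) ^+ 2)%:E <= \sum_(n <oo) (p n * (a n - b n) ^+ 2)%:E)%E.
Proof.
move=> a0 b0 BA aA bB; set x := A - B; have x0 : 0 <= x by rewrite subr_ge0.
set C := (\sum_(n <oo) _)%E.
have pc0 n : (0 <= (p n * (a n - b n) ^+ 2)%:E)%E by rewrite lee_fin mulr_ge0// sqr_ge0.
have : ((2 * x * A)%:E <= (x ^+ 2)%:E + C + (2 * x * B)%:E)%E.
  rewrite EFinM -aA [(2 * x * B)%:E]EFinM -bB.
  rewrite -[(x ^+ 2)%:E]mule1 -p_sum1 /C.
  rewrite -!nneseriesZl; last 3 first.
  - by move=> n _; rewrite lee_fin mulr_ge0.
  - by move=> n _; rewrite lee_fin.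
  - by move=> n _; rewrite lee_fin mulr_ge0.
  have px0 n : (0 <= (x ^+ 2)%:E * (p n)%:E)%E by rewrite -EFinM lee_fin mulr_ge0// sqr_ge0.
  have pb0 n : (0 <= (2 * x)%:E * (p n * b n)%:E)%E by rewrite -EFinM lee_fin !mulr_ge0.
  rewrite -nneseriesD// -nneseriesD//; last by move=> n _ _; exact: adde_ge0.
  apply: lee_nneseries => [n _ _|n _].
    by rewrite -EFinM lee_fin !mulr_ge0.
  rewrite -!EFinM -!EFinD lee_fin -subr_ge0.
  rewrite [leRHS](_ : _ = p n * (x - (a n - b n)) ^+ 2); last by ring.
  by rewrite mulr_ge0// sqr_ge0.
have : (0 <= C)%E by apply: nneseries_ge0.
case: C => [c _| |]; last by [].
- rewrite -!EFinD !lee_fin /x => h; nra.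
- by move=> _ _; rewrite leey.
Qed.

Lemma nneseries_sqr_le (a b : nat -> R) :
  (forall n, 0 <= a n) -> (forall n, 0 <= b n) ->
  (\sum_(n <oo) (p n * a n)%:E < +oo)%E ->
  (\sum_(n <oo) (p n * b n)%:E < +oo)%E ->
  ((\sum_(n <oo) (p n * a n)%:E - \sum_(n <oo) (p n * b n)%:E) ^+ 2 <=
   \sum_(n <oo) (p n * (a n - b n) ^+ 2)%:E)%E.
Proof.
move=> a0 b0 aoo boo.
have [A aA] : exists A, (\sum_(n <oo) (p n * a n)%:E = A%:E)%E.
  exists (fine (\sum_(n <oo) (p n * a n)%:E)%E); rewrite fineK// ge0_fin_numE//.
  by apply: nneseries_ge0 => n _ _; rewrite lee_fin mulr_ge0.
have [B bB] : exists B, (\sum_(n <oo) (p n * b n)%:E = B%:E)%E.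
  exists (fine (\sum_(n <oo) (p n * b n)%:E)%E); rewrite fineK// ge0_fin_numE//.
  by apply: nneseries_ge0 => n _ _; rewrite lee_fin mulr_ge0.
rewrite aA bB -EFinB -EFin_expe.
have [BA|/ltW AB] := leP B A; first exact: nneseries_sqr_le_half.
rewrite -sqrrN opprB; apply: le_trans (nneseries_sqr_le_half b a B A b0 a0 AB bB aA) _.
rewrite le_eqVlt; apply/orP; left; apply/eqP; apply: eq_eseriesr => n _.
by rewrite -sqrrN opprB.
Qed.

End jensen.

(** * Negative moments of the Poisson law *)

Lemma fact_leq_expn d m : ((m + d)`! <= d`! * m`! * m.+1 ^ d)%N.
Proof.
elim: d => [|d IH]; first by rewrite addn0 fact0 mul1n expn0 muln1.
rewrite addnS factS [d.+1`!]factS expnS.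
rewrite [leqRHS](_ : _ = (d.+1 * m.+1) * (d`! * m`! * m.+1 ^ d))%N; last first.
  by rewrite !mulnA; congr (_ * _)%N; rewrite -!mulnA; congr (_ * _)%N; lia.
by rewrite leq_mul//; lia.
Qed.

(** Termwise, the weight at [m] times [(r / (m + 1))^d] is at most [d!] times the weight at [m + d],
    and these shifted weights sum to at most 1. *)
Lemma poisson_neg_moment {R : realType} (r : R) d : 0 < r ->
  (\sum_(m <oo) (poisson_pmf r m * (r / m.+1%:R) ^+ d)%:E <= (d`!%:R)%:E)%E.
Proof.
move=> r0.
apply: (@le_trans _ _ (\sum_(m <oo) ((d`!%:R)%:E * (poisson_pmf r (m + d))%:E))%E).
  apply: lee_nneseries => [m _ _|m _].
    by rewrite lee_fin mulr_ge0 ?poisson_pmf_ge0// exprn_ge0// divr_ge0// ltW.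
  rewrite -EFinM lee_fin /poisson_pmf r0 expr_div_n exprD.
  rewrite [leLHS](_ : _ = r ^+ m * r ^+ d * expR (- r) *
    (m`!%:R * m.+1%:R ^+ d)^-1); last by rewrite invfM; ring.
  rewrite [leRHS](_ : _ = r ^+ m * r ^+ d * expR (- r) *
    (d`!%:R / (m + d)`!%:R)); last by ring.
  rewrite ler_wpM2l ?mulr_ge0 ?expR_ge0 ?exprn_ge0 ?(ltW r0)//.
  have p0 : 0 < m`!%:R * m.+1%:R ^+ d :> R.
    by rewrite mulr_gt0 ?exprn_gt0// ltr0n fact_gt0.
  have q0 : 0 < (m + d)`!%:R :> R by rewrite ltr0n fact_gt0.
  rewrite -[leLHS]mul1r ler_pdivrMr// mulrAC ler_pdivlMr// mul1r.
  by rewrite -natrX mulrA -!natrM ler_nat fact_leq_expn.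
rewrite nneseriesZl; last by move=> m _; rewrite lee_fin poisson_pmf_ge0.
rewrite (@nneseries_addn _ (fun m => (poisson_pmf r m)%:E) d); last first.
  by move=> m; rewrite lee_fin poisson_pmf_ge0.
rewrite -[leRHS]mule1 lee_wpmul2l ?lee_fin// -(poisson_pmf_sum1 _ r0).
rewrite [leRHS](nneseries_split 0 d)//; last first.
  by move=> m _; rewrite lee_fin poisson_pmf_ge0.
rewrite add0n leeDr// sume_ge0// => m _.
by rewrite lee_fin poisson_pmf_ge0.
Qed.

(** * Mean square of the walk average *)

Section walk_average.
Context {R : realType} {d : nat}.
Variable P : probability (env R d) R.
Hypothesis d_gt0 : (0 < d)%N.
Hypothesis P_invariant : forall (x : Zd d) (A : set (env R d)),
  measurable A -> P (env_shift x @^-1` A) = P A.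
Context {dW : measure_display} {W : measurableType dW}.
Variables (Q : probability W R) (X : R -> W -> Zd d).
Hypothesis hX : simple_walk Q X.
Variables (f : env R d -> R) (t : R).
Hypotheses (mf : measurable_fun setT f) (t_gt0 : 0 < t).
Hypothesis f_sq : (sqnorm P f < +oo)%E.

Local Notation L := (lazy (env R d) (@env_shift R d)).
Local Notation mu := (2 * (2 * d%:R * t)).
Local Notation p := (poisson_pmf mu).

Let mu_gt0 : 0 < mu :> R.
Proof. by rewrite !mulr_gt0// ltr0n. Qed.

Let p_ge0 n : 0 <= p n.
Proof. exact: poisson_pmf_ge0. Qed.

Let ge0_integral_env (g : env R d -> R) w : (forall w, 0 <= g w) ->
  (\int[Q]_u (g (env_shift (X t u) w))%:E = \sum_(m <oo) (p m * iter m L g w)%:E)%E.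
Proof.
move=> g0; pose h x := g (env_shift x w).
rewrite (ge0_integral_walk Q X d_gt0 hX h)//; last by move=> x; exact: g0.
rewrite poisson_lazy//; last 2 first.
- by move=> x; exact: g0.
- by rewrite !mulr_gt0// ltr0n.
apply: eq_eseriesr => m _; congr (_ * _)%:E.
have := iter_avg_fcomp (@lazy_weight R d) (lazy_step (env R d) (@env_shift R d))
  (Zd d) (lazy_step (Zd d) (fun v x => x + v)) (fun x => env_shift x w) g m 0.
rewrite env_shift0; apply.
by move=> [e|] x //=; rewrite env_shiftD.
Qed.

Let fp w := Num.max (f w) 0.
Let fm w := Num.max (- f w) 0.

Let fp_ge0 w : 0 <= fp w.
Proof. by rewrite le_max lexx orbT. Qed.
Let fm_ge0 w : 0 <= fm w.
Proof. by rewrite le_max lexx orbT. Qed.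

Let mfp : measurable_fun setT fp.
Proof. by apply: measurable_maxr => //; exact: measurable_cst. Qed.

Let mfm : measurable_fun setT fm.
Proof.
apply: measurable_maxr; last exact: measurable_cst.
exact: measurableT_comp.
Qed.

Let fB w : fp w - fm w = f w.
Proof.
rewrite /fp /fm; have [f0|f0] := leP (f w) 0.
  by rewrite max_l ?oppr_ge0// sub0r opprK.
by rewrite max_r ?subr0// oppr_le0 ltW.
Qed.

Let S (g : env R d -> R) w := (\sum_(m <oo) (p m * iter m L g w)%:E)%E.

Let walk_averageE w : walk_average Q X f t w = (S fp w - S fm w)%E.
Proof.
rewrite /walk_average integralE; congr (_ - _)%E.
- rewrite -[RHS]ge0_integral_env//; apply: eq_integral => u _.
  by rewrite funeposE -fine_max.
- rewrite -[RHS]ge0_integral_env//; apply: eq_integral => u _.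
  by rewrite funenegE -EFinN -fine_max.
Qed.

Let pL_ge0 (g : env R d -> R) m w : (forall w, 0 <= g w) ->
  (0 <= (p m * iter m L g w)%:E)%E.
Proof.
move=> g0; rewrite lee_fin mulr_ge0//; apply: iter_avg_ge0 => // s.
exact: lazy_weight_ge0.
Qed.

Let S_ge0 (g : env R d -> R) w : (forall w, 0 <= g w) -> (0 <= S g w)%E.
Proof.
by move=> g0; apply: nneseries_ge0 => m _ _; exact: pL_ge0.
Qed.

Let measurable_pL (g : env R d -> R) m : measurable_fun setT g ->
  measurable_fun setT (fun w => (p m * iter m L g w)%:E).
Proof.
move=> mg; apply/measurable_EFinP; apply: measurable_funM => //.
exact: (measurable_iter_lazy P P_invariant).
Qed.

Let measurable_S (g : env R d -> R) : measurable_fun setT g ->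
  (forall w, 0 <= g w) -> measurable_fun setT (S g).
Proof.
move=> mg g0; apply: ge0_emeasurable_sum => [m w _ _|m _]; first exact: pL_ge0.
exact: measurable_pL.
Qed.

Let integral_S (g : env R d -> R) : measurable_fun setT g ->
  (forall w, 0 <= g w) -> (\int[P]_w S g w = \int[P]_w (g w)%:E)%E.
Proof.
move=> mg g0; rewrite integral_nneseries//; last 2 first.
- by move=> m; exact: measurable_pL.
- by move=> m w _; exact: pL_ge0.
transitivity (\sum_(m <oo) (\int[P]_w (g w)%:E * (p m)%:E))%E.
  apply: eq_eseriesr => m _; under eq_integral do rewrite EFinM.
  rewrite ge0_integralZl_EFin//.
  - rewrite muleC; congr (_ * _)%E.
    apply: (ge0_integral_iter_avg P) => //; first exact: lazy_weight_ge0.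
    + exact: lazy_weight_sum1.
    + exact: lazy_step_preserves.
  - move=> w _; rewrite lee_fin; apply: iter_avg_ge0 => // s.
    exact: lazy_weight_ge0.
  - by apply/measurable_EFinP; exact: (measurable_iter_lazy P P_invariant).
have I0 : (0 <= \int[P]_w (g w)%:E)%E by apply: integral_ge0 => w _; rewrite lee_fin.
case: (\int[P]_w (g w)%:E)%E I0 => [r|_|//].
  rewrite lee_fin => r0; rewrite nneseriesZl => [|m _]; last by rewrite lee_fin.
  by rewrite poisson_pmf_sum1// mule1.
(* When the integral of [g] is infinite, the term [m = 0] of positive weight already makes the
   series infinite. *)
rewrite (@nneseries_pinfty _ _ _ 0%N)// => [m _|]; first by rewrite mule_ge0// lee_fin.
rewrite mulyr gtr0_sg ?mul1e// /poisson_pmf mu_gt0 mulr_gt0 ?expR_gt0//.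
by rewrite divr_gt0 ?exprn_gt0// ltr0n fact_gt0.
Qed.

(** A function below [1 + f^2] is integrable since [P] is finite, and [S] preserves the integral by
    stationarity. *)
Let S_fin (g : env R d -> R) : measurable_fun setT g -> (forall w, 0 <= g w) ->
  (forall w, g w <= 1 + f w ^+ 2) -> {ae P, forall w, (S g w < +oo)%E}.
Proof.
move=> mg g0 gf.
have iS : P.-integrable setT (S g).
  apply/integrableP; split; first exact: measurable_S.
  under eq_integral do rewrite gee0_abs ?S_ge0//.
  rewrite integral_S//.
  apply: (@le_lt_trans _ _ (\int[P]_w (1%:E + (f w ^+ 2)%:E))%E).
    apply: ge0_le_integral => //.
    - by move=> w _; rewrite lee_fin.
    - exact/measurable_EFinP.
    - by apply: emeasurable_funD => //; exact: measurable_sqrE.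
    - by move=> w _; rewrite -EFinD lee_fin.
  rewrite ge0_integralD//; last 2 first.
  - by move=> w _; rewrite lee_fin sqr_ge0.
  - exact: measurable_sqrE.
  apply: lte_add_pinfty => //; apply: (@le_lt_trans _ _ 1%E); last exact: ltry.
  by rewrite integral_cst// mul1e; exact: probability_le1.
have := integrable_ae measurableT iS; apply: filterS => w /(_ I).
by rewrite ge0_fin_numE// S_ge0.
Qed.

(** Jensen's inequality for the Poisson weights at almost every environment, where both [S fp] and
    [S fm] are finite and may be subtracted, followed by exchange of sum and integral. *)
Lemma walk_average_sqr_le :
  (\int[P]_w (walk_average Q X f t w ^+ 2) <=
   \sum_(m <oo) (p m)%:E * sqnorm P (iter m L f))%E.
Proof.
have mL m : measurable_fun setT (iter m L f) by exact: (measurable_iter_lazy P P_invariant).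
have pL0 m w : (0 <= (p m * iter m L f w ^+ 2)%:E)%E.
  by rewrite lee_fin mulr_ge0// sqr_ge0.
have mpL m : measurable_fun setT (fun w => (p m * iter m L f w ^+ 2)%:E).
  by apply/measurable_EFinP; apply: measurable_funM => //; exact: measurable_funX.
apply: (@le_trans _ _ (\int[P]_w \sum_(m <oo) (p m * iter m L f w ^+ 2)%:E)%E).
  apply: ae_ge0_le_integral => //.
  - move=> w _; rewrite expe2; case: (walk_average _ _ _ _ _) => [x| |].
    + by rewrite -EFinM lee_fin -expr2 sqr_ge0.
    + by rewrite mulyy leey.
    + by rewrite mulNyNy leey.
  - under eq_fun do rewrite walk_averageE expe2.
    by apply: emeasurable_funM; apply: emeasurable_funB; exact: measurable_S.
  - by move=> w _; exact: nneseries_ge0.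
  - exact: ge0_emeasurable_sum.
  have fp1 w : fp w <= 1 + f w ^+ 2.
    by rewrite /fp ge_max addr_ge0 ?sqr_ge0// andbT; nra.
  have fm1 w : fm w <= 1 + f w ^+ 2.
    by rewrite /fm ge_max addr_ge0 ?sqr_ge0// andbT; nra.
  have := S_fin fp mfp fp_ge0 fp1; have := S_fin fm mfm fm_ge0 fm1.
  apply: filterS2 => w Sm Sp _; rewrite walk_averageE.
  have := nneseries_sqr_le p p_ge0 (poisson_pmf_sum1 _ mu_gt0)
    (fun m => iter m L fp w) (fun m => iter m L fm w).
  have Lge0 (g : env R d -> R) : (forall w, 0 <= g w) -> forall m, 0 <= iter m L g w.
    by move=> g0 m; apply: iter_avg_ge0 => // s; exact: lazy_weight_ge0.
  move=> /(_ (Lge0 _ fp_ge0) (Lge0 _ fm_ge0) Sp Sm) /le_trans; apply.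
  rewrite le_eqVlt; apply/orP; left; apply/eqP; apply: eq_eseriesr => m _.
  by rewrite -iter_avgB; congr (_ * _ ^+ 2)%:E; congr (iter m L _ w); apply/funext.
rewrite integral_nneseries//; apply: lee_nneseries => m _.
  by move=> _; apply: integral_ge0.
under eq_integral do rewrite EFinM.
rewrite ge0_integralZl_EFin//; first by move=> w _; rewrite lee_fin sqr_ge0.
exact: measurable_sqrE.
Qed.

End walk_average.

Theorem theorem2p1 (R : realType) (d : nat) (hd : (1 <= d)%N)
  (P : probability (env R d) R)
  (P_invariant : forall (x : Zd d) (A : set (env R d)),
    measurable A -> P (env_shift x @^-1` A) = P A)
  (P_ge1 : forall e : edge d, {ae P, forall w : env R d, 1 <= (w e)%:num})
  (P_non_explosive : {ae P, forall w : env R d, non_explosive w})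
  (dW : measure_display) (W : measurableType dW) (Q : probability W R)
  (X : R -> W -> Zd d) (hX : simple_walk Q X) :
  exists C : R, 0 < C /\
    forall f : env R d -> R, measurable_fun setT f ->
      calN P f \is a fin_num ->
      forall t : R, 0 < t ->
        (\int[P]_w (walk_average Q X f t w ^+ 2) <=
         C%:E * (calN P f / (t `^ (d%:R / 2))%:E))%E.
Proof.
pose c := (2 ^ d.+1 * d ^ 2 * (4 * d + 2))%N.
pose C0 : R := 4 * (4 * c)%:R ^+ d.
have C0_gt0 : 0 < C0.
  rewrite /C0 mulr_gt0// exprn_gt0// ltr0n /c !muln_gt0 !expn_gt0 hd/=; lia.
(* [C0] comes from [sqnorm_iter_lazy_decay] and [d!] from [poisson_neg_moment]. *)
exists (C0 * (1 + d`!%:R)); split; first by rewrite mulr_gt0// ltr_pwDl.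
move=> f mf Nf t t0.
have [r rN] : exists r, calN P f = r%:E by exists (fine (calN P f)); rewrite fineK.
have Nr : (calN P f <= r%:E)%E by rewrite rN.
have r0 : 0 <= r := calN_ge0 P f r Nr.
pose mu : R := 2 * (2 * d%:R * t).
have d0 : 0 < d%:R :> R by rewrite ltr0n.
have mu0 : 0 < mu by rewrite /mu !mulr_gt0.
have mu_s : Num.sqrt mu ^+ 2 = mu by rewrite sqr_sqrtr// ltW.
have s0 : 0 < Num.sqrt mu by rewrite sqrtr_gt0.
have fsq : (sqnorm P f < +oo)%E.
  by apply: le_lt_trans (sqnorm_le_calN P hd f r mf Nr) _; rewrite ltry.
apply: le_trans (walk_average_sqr_le P hd P_invariant Q X hX f t mf t0 fsq) _.
pose k : R := C0 * r / Num.sqrt mu ^+ d.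
have k0 : 0 <= k by rewrite /k divr_ge0 ?mulr_ge0 ?exprn_ge0// ltW.
apply: (@le_trans _ _ (\sum_(m <oo)
    (k%:E * ((poisson_pmf mu m)%:E + (poisson_pmf mu m * (mu / m.+1%:R) ^+ d)%:E)))%E).
  apply: lee_nneseries => m _.
    by move=> _; rewrite mule_ge0 ?sqnorm_ge0// lee_fin poisson_pmf_ge0.
  (* The scale is [s = sqrt mu], where [mu] is the mean number of lazy steps, so that the remaining
     ratio is [mu / (m + 1)]. *)
  have := sqnorm_iter_lazy_decay P hd P_invariant f r mf Nr m (Num.sqrt mu) s0.
  rewrite mu_s -/c -/C0 -/k => h.
  apply: (@le_trans _ _ ((poisson_pmf mu m)%:E * (k * (1 + (mu / m.+1%:R) ^+ d))%:E)%E).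
    by rewrite lee_wpmul2l// lee_fin poisson_pmf_ge0.
  by rewrite -EFinD -!EFinM lee_fin le_eqVlt; apply/orP; left; apply/eqP; ring.
have q0 m : (0 <= (poisson_pmf mu m * (mu / m.+1%:R) ^+ d)%:E)%E.
  by rewrite lee_fin mulr_ge0 ?poisson_pmf_ge0// exprn_ge0// divr_ge0// ltW.
have p0 m : (0 <= (poisson_pmf mu m)%:E)%E by rewrite lee_fin poisson_pmf_ge0.
rewrite nneseriesZl; last by move=> m _; exact: adde_ge0.
rewrite nneseriesD// poisson_pmf_sum1//.
apply: (@le_trans _ _ (k%:E * (1 + d`!%:R)%:E)%E).
  by rewrite EFinD lee_wpmul2l ?lee_fin// leeD2l// poisson_neg_moment.
have tdE : t `^ (d%:R / 2) = Num.sqrt t ^+ d.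
  by rewrite mulrC powRrM powR12_sqrt ?ltW// powR_mulrn// sqrtr_ge0.
have st0 : 0 < Num.sqrt t by rewrite sqrtr_gt0.
have td0 : 0 < Num.sqrt t ^+ d by rewrite exprn_gt0.
rewrite rN tdE inver gt_eqF// -!EFinM lee_fin /k.
rewrite [leRHS](_ : _ = C0 * r * (1 + d`!%:R) / Num.sqrt t ^+ d); last by ring.
rewrite [leLHS](_ : _ = C0 * r * (1 + d`!%:R) / Num.sqrt mu ^+ d); last by ring.
rewrite ler_wpM2l ?mulr_ge0 ?addr_ge0 ?(ltW C0_gt0)//.
rewrite lef_pV2 ?posrE ?exprn_gt0//.
rewrite lerXn2r ?nnegrE ?sqrtr_ge0// ler_sqrt /mu; last exact: ltW.
(* Only [mu = 4 d t >= t] is left to check. *)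
have : 1 <= d%:R :> R by rewrite ler1n.
by nra.
Qed.
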